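(* Let $(B,\|\cdot\|)$ be a Banach space having a second norm $|\cdot|$ (with respect to which $B$ is generically not complete). For a bounded linear operator $Q:B\to B$ put $|||Q|||:=\sup_{\|\phi\|\le1}|Q\phi|$. Let $I\subsetneq\mathbb R^d$ or $I\subsetneq\mathbb C^d$, let $\{P_v:B\to B,\ v\in I\}$ be a family of bounded linear operators, and fix $o\in I$. Suppose there are $C,M>0$ and $\theta\in(0,1)$, $\theta<M$, such that for all $v\in I$, $n\in\mathbb N$, $\phi\in B$: 1. $|\phi|\le C\|\phi\|$; 2. $|P_v^n|\le CM^n$ (operator norm with respect to $|\cdot|$, i.e. $|P_v^n\phi|\le CM^n|\phi|$); 3. $\|P_v^n\phi\|\le C\theta^n\|\phi\|+CM^n|\phi|$; 4. if $z\in\sigma(P_v)$ and $|z|>\theta$, then $z$ is not in the residual spectrum of $P_v$; 5. $\tau_v:=|||P_o-P_v|||\to0$ as $v\to o$. Fix $\delta>0$ and $r\in(\theta,M)$. Let $\eta:=\frac{\log (r/\theta)}{\log (M/\theta)}\in(0,1)$ and $V_{\delta,r}:=\{z\in\mathbb C:|z|<r\text{ or }\mathrm{dist}(z,\sigma(P_o))<\delta\}$. Then there are constants $\epsilon_{\delta,r},b_{\delta,r}>0$ and $a_r>0$ ($a_r$ not depending on $\delta$) such that for every $v$ with $\mathrm{dist}(v,o)\le\epsilon_{\delta,r}$ and every $\phi\in B$, $$\sup_{z\notin V_{\delta,r}}\|(z-P_v)^{-1}\phi\|\le a_r\|\phi\|+b_{\delta,r}|\phi|,\qquad \sup_{z\notin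 V_{\delta,r}}|||(z-P_v)^{-1}-(z-P_o)^{-1}|||\precsim_{\delta,r}\tau_v^{1/2}+\tau_v^{\frac{\eta}{2(1-\eta)}},$$ where the constant in $\precsim_{\delta,r}$ does not depend on $v$. If $\lambda$ is an isolated eigenvalue of $P_o$ with $|\lambda|>\theta$, choose any $\delta<a_r^{-1}$ such that $B_\delta(\lambda)\cap\sigma(P_o)=\{\lambda\}$ and define $\mathrm{Proj}_v^{\lambda,\delta}:=\frac1{2\pi i}\int_{\partial B_\delta(\lambda)}(z-P_v)^{-1}dz$. Then there is a constant $\epsilon'_{\delta,r}>0$ such that for every $v$ with $\mathrm{dist}(v,o)\le\epsilon'_{\delta,r}$, $$\mathrm{rank}(\mathrm{Proj}_v^{\lambda,\delta})=\mathrm{rank}(\mathrm{Proj}_o^{\lambda,\delta}),\quad \|\mathrm{Proj}_v^{\lambda,\delta}\|\le\delta(a_r+b_{\delta,r}),\quad |||\mathrm{Proj}_v^{\lambda,\delta}-\mathrm{Proj}_o^{\lambda,\delta}|||\precsim_{\delta,r}\tau_v^{1/2}+\tau_v^{\frac{\eta}{2(1-\eta)}}.$$ Suppose that $\partial B_r(0)\cap\sigma(P_o)=\emptyset$ and define $\mathrm{Proj}_v^{r}:=\frac1{2\pi i}\int_{\partial B_r(0)}(z-P_v)^{-1}dz$. Then for every $v$ with $\mathrm{dist}(v,o)\le\epsilon_{\delta,r}$, $\|P_v^n\circ\mathrm{Proj}_v^r\|\le r^{n+1}(a_r+b_{\delta,r})$.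
   Context: $\mathbb N=\{1,2,\dots\}$. $\sigma(P)$ is the spectrum of $P$ on $B$ (complex Banach space). ''$z$ is in the residual spectrum of $P_v$'' means that $z-P_v$ is injective but does not have dense range. $B_r(z)$ is the open disk in $\mathbb C$ with center $z$ and radius $r$. $\mathrm{dist}$ on $I$ is the Euclidean distance. $x_v\precsim_{\delta,r}y_v$ means $x_v\le C_{\delta,r}y_v$ for a constant $C_{\delta,r}$ depending on $\delta,r$ but not on $v$.
   Formalization: In the part on isolated eigenvalues, |λ|>θ is replaced by |λ|>r (for θ<|λ|≤r the claim is false, as ranks can differ and the rate can fail), and the circle ∂B_δ(λ) is assumed not to meet σ(P_o), so that Proj_o is defined. *)

(* Defs.v *)
From mathcomp Require Import ssreflect ssrfun ssrbool eqtype ssrnat fintype.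
From mathcomp Require Import finfun bigop.
From Stdlib Require Import Reals.
From Coquelicot Require Export Coquelicot.
From Stdlib Require Import Lra.

Open Scope R_scope.

Definition euclid_dist {K : AbsRing} {d : nat} (v w : {ffun 'I_d -> K}) : R :=
  sqrt (\big[Rplus/0]_(i < d) (abs (minus (v i) (w i))) ^ 2).

(* Stdlib has ln 0 = 0, hence Rpower 0 y = 1. *)
Definition rpow (x y : R) : R :=
  if Req_EM_T x 0 then 0 else Rpower x y.

Definition dist_to_set (z : C) (S : C -> Prop) : Rbar :=
  Glb_Rbar (fun x => exists w : C, S w /\ x = Cmod (z - w)%C).

(* Restriction of scalars from C to R, which [RInt] requires; the carrier, the
   norm and the topology of B are kept. *)
Section RestrictionOfScalars.

Variable B : CompleteNormedModule C_AbsRing.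

Definition real_scal (a : R) (x : B) : B := scal (RtoC a) x.

Lemma real_scal_assoc (x y : R_Ring) (u : B) :
  real_scal x (real_scal y u) = real_scal (mult x y) u.
Proof.
rewrite /real_scal scal_assoc; congr scal.
by symmetry; apply: RtoC_mult.
Qed.

Lemma real_scal_one (u : B) : real_scal (one : R_Ring) u = u.
Proof. exact: (scal_one u). Qed.

Lemma real_scal_distr_l (x : R_Ring) (u v : B) :
  real_scal x (plus u v) = plus (real_scal x u) (real_scal x v).
Proof. exact: (scal_distr_l (RtoC x) u v). Qed.

Lemma real_scal_distr_r (x y : R_Ring) (u : B) :
  real_scal (plus x y) u = plus (real_scal x u) (real_scal y u).
Proof.
rewrite /real_scal -scal_distr_r; congr scal.
exact: RtoC_plus.
Qed.

Lemma norm_real_scal (l : R_AbsRing) (x : B) :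
  norm (real_scal l x) <= abs l * norm x.
Proof.
have := norm_scal (RtoC l) x.
by rewrite -[abs (RtoC l)]/(Cmod (RtoC l)) Cmod_R.
Qed.

Definition real_ModuleSpace_mixin :=
  ModuleSpace.Mixin R_Ring (CompleteNormedModule.AbelianGroup _ B) real_scal
    real_scal_assoc real_scal_one real_scal_distr_l real_scal_distr_r.

Definition real_NormedModuleAux : NormedModuleAux R_AbsRing :=
  NormedModuleAux.Pack R_AbsRing B
    (NormedModuleAux.Class R_AbsRing B
       (ModuleSpace.Class R_Ring B
          (AbelianGroup.class (CompleteNormedModule.AbelianGroup _ B))
          real_ModuleSpace_mixin)
       (UniformSpace.class (CompleteNormedModule.UniformSpace _ B)))
    B.

Definition real_NormedModule_mixin :=
  NormedModule.Mixin R_AbsRing real_NormedModuleAux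
    (@norm _ B) (@norm_factor _ B)
    (@norm_triangle _ B) norm_real_scal (@norm_compat1 _ B)
    (@norm_compat2 _ B) (@norm_eq_zero _ B).

Definition realify : CompleteNormedModule R_AbsRing :=
  CompleteNormedModule.Pack R_AbsRing B
    (CompleteNormedModule.Class R_AbsRing B
       (NormedModule.Class R_AbsRing B
          (NormedModuleAux.class _ real_NormedModuleAux)
          real_NormedModule_mixin)
       (CompleteSpace.class (CompleteNormedModule.CompleteSpace _ B)))
    B.

End RestrictionOfScalars.

(* Bounded operators on B are plain functions satisfying Coquelicot's [is_linear]
   (additive, C-homogeneous and bounded). *)
Section Operators.

Variable B : CompleteNormedModule C_AbsRing.
Implicit Types (P Q T : B -> B) (z : C).

Definition is_norm (N : B -> R) : Prop :=
  (forall x y : B, N (plus x y) <= N x + N y) /\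
  (forall (c : C) (x : B), N (scal c x) = Cmod c * N x) /\
  (forall x : B, N x = 0 -> x = zero).

(* The supremum of N (Q phi) over the unit ball of the Banach norm: the operator
   norm for N the Banach norm, the mixed norm |||Q||| for N the second norm. *)
Definition op_norm (N : B -> R) Q : Rbar :=
  Lub_Rbar (fun x => exists phi : B, norm phi <= 1 /\ x = N (Q phi)).

Definition op_minus P Q : B -> B := fun phi => minus (P phi) (Q phi).

Definition z_minus z P : B -> B := fun phi => minus (scal z phi) (P phi).

Definition spectrum P : C -> Prop := fun z =>
  ~ exists Q : B -> B, is_linear Q /\
      (forall phi, Q (z_minus z P phi) = phi) /\
      (forall phi, z_minus z P (Q phi) = phi).

(* Meaningful for z outside [spectrum P], where the preimage is unique. *)
Definition resolvent P z : B -> B := fun phi =>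
  iota (fun psi : B => z_minus z P psi = phi).

Definition residual_spectrum P : C -> Prop := fun z =>
  (forall x y : B, z_minus z P x = z_minus z P y -> x = y) /\
  ~ (forall (y : B) (e : posreal), exists x : B,
       norm (minus y (z_minus z P x)) < e).

Definition eigenvalue P z : Prop :=
  exists phi : B, phi <> zero /\ P phi = scal z phi.

Definition isolated_eigenvalue P z : Prop :=
  eigenvalue P z /\
  exists e : posreal, forall w, spectrum P w -> Cmod (w - z)%C < e -> w = z.

(* The dimension of the range of T, in {0, 1, 2, ...} or p_infty: the supremum of
   the n such that the range contains n linearly independent vectors. *)
Definition rank T : Rbar :=
  Lub_Rbar (fun x => exists (n : nat) (e : nat -> B), x = INR n /\
    forall c : nat -> C,
      sum_n_m (fun i => scal (c i) (T (e i))) 1 n = zero ->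
      forall i : nat, (1 <= i <= n)%nat -> c i = RtoC 0).

Definition circle_pt (c : C) (rho t : R) : C :=
  (c + RtoC rho * (cos t, sin t))%C.

Definition circle_integral (f : C -> B) (c : C) (rho : R) : B :=
  RInt (V := realify B)
    (fun t => scal (Ci * RtoC rho * (cos t, sin t))%C (f (circle_pt c rho t)))
    0 (2 * PI).

(* (1 / 2 i pi) times the integral of (z - P)^-1 over the positively oriented
   circle of center c and radius rho, as a pointwise (strong) integral. *)
Definition circle_proj P (c : C) (rho : R) : B -> B := fun phi =>
  scal (/ (RtoC (2 * PI) * Ci))%C
    (circle_integral (fun z => resolvent P z phi) c rho).

Definition V_region P (delta r : R) : C -> Prop := fun z =>
  Cmod z < r \/ Rbar_lt (dist_to_set z (spectrum P)) delta.

End Operators.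

Arguments is_norm {B} N.
Arguments op_norm {B} N Q.
Arguments op_minus {B} P Q _.
Arguments z_minus {B} z P _.
Arguments spectrum {B} P _.
Arguments resolvent {B} P z _.
Arguments residual_spectrum {B} P _.
Arguments eigenvalue {B} P z.
Arguments isolated_eigenvalue {B} P z.
Arguments rank {B} T.
Arguments circle_integral {B} f c rho.
Arguments circle_proj {B} P c rho _.
Arguments V_region {B} P delta r _.

(* Main.v *)
Require Import Defs.
From mathcomp Require Import ssreflect ssrfun ssrbool eqtype ssrnat fintype.
From mathcomp Require Import finfun bigop.
From Stdlib Require Import Reals Lra Lia Classical IndefiniteDescription List.
From Coquelicot Require Import Coquelicot.
Open Scope R_scope.

(** Solving [z phi = P phi + psi] for [phi] and iterating [n] times bounds [phi]
    by [P^n phi] and by geometric sums in [psi]. Used on an operator that obeys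
    the two-norm inequalities, this gives two estimates for
    [psi = z phi - P phi] and [|z|] at least [r > theta]. The strong one
    ([strong_estimate]) bounds [norm phi] by [norm psi] and [nw psi], up to a
    multiple of the weak norm [nw phi]. The weak one ([weak_estimate]) assumes
    in addition [k * norm phi <= norm (z phi - P phi)] for all [phi], and bounds
    [nw phi] by a small multiple of [norm psi] and a large multiple of [nw psi].

    Perturbation of the resolvent. Let [z - P o] have an inverse bounded by
    [/ k]. Apply the strong estimate to [P v], and bound the weak norm that it
    leaves by the weak estimate for [P o]; since [P o - P v] is small from the
    Banach norm to the weak norm, the error is absorbed. Hence
    [norm phi <= a * norm psi + b * nw psi] with [psi = z phi - P v phi], where
    only [b] depends on [k] ([stability]). So [z - P v] is bounded below; its
    range is closed, and dense as [z] is not in the residual spectrum, so [z] is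
    outside the spectrum. The weak estimate for [P v], applied to the
    difference of the two resolvents, gives the rate after optimisation over the
    number of iterates ([resolvent_rate]). That [k] can be chosen uniformly in
    [z], and for all admissible eigenvalues [lambda] at once, is a compactness
    argument; the resolvent set is open because a lower bound persists under
    small changes of [z], and the hypothesis on the residual spectrum does the
    rest.

    Riesz projections. The circle integral is the limit of averages [e] over the
    [n]-th roots of unity. If [T = P - c], partial fractions give
    [(rho^n - T^n) e phi = rho^n phi], and therefore
    [(rho2^n - rho1^n) e1 e2 = rho2^n e1 - rho1^n e2] for the averages over two
    radii [rho1 < rho2]. In the limit [E1 E2 = E2 E1 = E1], whether or not the
    spectrum meets the annulus in between. When it does not, the projections are
    Lipschitz in the radius, so they are idempotent, and those of two nearby radii
    differ by an idempotent of norm less than one, that is, they are equal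
    ([circle_proj_radius]). This replaces Cauchy's theorem.

    Ranks. On the range of a projection [E] over a circle of radius
    [delta < / a], [phi = E phi] gives
    [norm phi <= delta * (a * norm phi + b * nw phi)], so the Banach norm is
    bounded there by the weak norm. As the projections are close from the Banach
    norm to the weak norm, each is injective on the range of the other
    ([projection_rank_le]). The difference of the projections is estimated on a
    smaller circle that lies in [|z| >= r], where the full rate is available. *)

(** * Identities in modules over C *)

Section ModuleIdentities.

Variable V : ModuleSpace C_Ring.

(** Formal linear combinations, for a decision procedure by reflection: an
    identity in a module is reduced to identities in C, which [ring] proves. *)
Inductive mexpr :=
  | MVar of nat
  | MZero
  | MPlus of mexpr & mexpr
  | MOpp of mexpr
  | MScal of C & mexpr.

Fixpoint meval (env : list V) (e : mexpr) : V :=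
  match e with
  | MVar i => List.nth i env zero
  | MZero => zero
  | MPlus a b => plus (meval env a) (meval env b)
  | MOpp a => opp (meval env a)
  | MScal c a => scal c (meval env a)
  end.

Fixpoint mcoef (e : mexpr) (i : nat) : C :=
  match e with
  | MVar j => if Nat.eqb j i then RtoC 1 else RtoC 0
  | MZero => RtoC 0
  | MPlus a b => Cplus (mcoef a i) (mcoef b i)
  | MOpp a => Copp (mcoef a i)
  | MScal c a => Cmult c (mcoef a i)
  end.

Fixpoint mcombine (env : list V) (c : nat -> C) : V :=
  match env with
  | nil => zero
  | cons x l => plus (scal (c 0%nat) x) (mcombine l (fun i => c i.+1))
  end.

Fixpoint mcoefs_eq (n : nat) (c c' : nat -> C) : Prop :=
  match n with
  | 0%nat => True
  | m.+1 => c 0%nat = c' 0%nat /\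
      mcoefs_eq m (fun i => c i.+1) (fun i => c' i.+1)
  end.

Lemma mcombine_ext env c c' :
  mcoefs_eq (length env) c c' -> mcombine env c = mcombine env c'.
Proof.
elim: env c c' => [//|x l IH] c c' /= [-> H].
by rewrite (IH _ _ H).
Qed.

Lemma mcombine_zero env : mcombine env (fun=> RtoC 0) = zero.
Proof.
elim: env => [//|x l /= ->].
by rewrite (scal_zero_l x) plus_zero_l.
Qed.

Lemma mcombine_plus env c c' :
  mcombine env (fun i => Cplus (c i) (c' i))
  = plus (mcombine env c) (mcombine env c').
Proof.
elim: env c c' => [|x l IH] c c' /=; first by rewrite plus_zero_l.
rewrite IH (scal_distr_r (c 0%nat) (c' 0%nat) x) -!plus_assoc; congr plus.
by rewrite plus_assoc [plus (scal (c' 0%nat) x) _]plus_comm -plus_assoc.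
Qed.

Lemma mcombine_scal env (a : C) c :
  mcombine env (fun i => Cmult a (c i)) = scal a (mcombine env c).
Proof.
elim: env c => [|x l IH] c /=; first by rewrite scal_zero_r.
by rewrite IH scal_distr_l (scal_assoc a (c 0%nat) x).
Qed.

Lemma mcombine_opp env c :
  mcombine env (fun i => Copp (c i)) = opp (mcombine env c).
Proof.
elim: env c => [|x l IH] c /=; first by rewrite opp_zero.
by rewrite IH opp_plus -(scal_opp_l (c 0%nat) x).
Qed.

Lemma mcombine_var env j :
  mcombine env (fun i => if Nat.eqb j i then RtoC 1 else RtoC 0)
  = List.nth j env zero.
Proof.
elim: env j => [|x l IH] [|j] //=.
  by rewrite mcombine_zero (scal_one x) plus_zero_r.
by rewrite IH (scal_zero_l x) plus_zero_l.
Qed.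

Lemma meval_combine env e : meval env e = mcombine env (mcoef e).
Proof.
elim: e => [j||a IHa b IHb|a IHa|c a IHa] /=.
- by rewrite mcombine_var.
- by rewrite mcombine_zero.
- by rewrite mcombine_plus IHa IHb.
- by rewrite mcombine_opp IHa.
- by rewrite mcombine_scal IHa.
Qed.

Lemma meval_eq env e e' :
  mcoefs_eq (length env) (mcoef e) (mcoef e') -> meval env e = meval env e'.
Proof. by move=> H; rewrite !meval_combine; apply: mcombine_ext. Qed.

End ModuleIdentities.

Ltac mem_index x env :=
  lazymatch env with
  | cons x _ => constr:(0%nat)
  | cons _ ?l => let n := mem_index x l in constr:(S n)
  end.

Ltac add_atom x env :=
  match env with
  | context [cons x _] => env
  | _ => constr:(cons x env)
  end.

Ltac collect_atoms e env :=
  lazymatch e with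
  | zero => env
  | plus ?a ?b => let env' := collect_atoms a env in collect_atoms b env'
  | minus ?a ?b => let env' := collect_atoms a env in collect_atoms b env'
  | opp ?a => collect_atoms a env
  | scal _ ?a => collect_atoms a env
  | _ => add_atom e env
  end.

Ltac reify_module e env :=
  lazymatch e with
  | zero => constr:(MZero)
  | plus ?a ?b =>
      let a' := reify_module a env in let b' := reify_module b env in
      constr:(MPlus a' b')
  | minus ?a ?b =>
      let a' := reify_module a env in let b' := reify_module b env in
      constr:(MPlus a' (MOpp b'))
  | opp ?a => let a' := reify_module a env in constr:(MOpp a')
  | scal ?c ?a => let a' := reify_module a env in constr:(MScal c a')
  | _ => let i := mem_index e env in constr:(MVar i)
  end.

(** Leaves one equation in C for each vector that occurs in the goal. *)
Ltac compare_coefficients B :=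
  rewrite /z_minus /op_minus;
  lazymatch goal with
  | |- @eq _ ?x ?y =>
    let e0 := constr:(@nil (ModuleSpace.sort _ (CompleteNormedModule.ModuleSpace _ B))) in
    let e1 := collect_atoms x e0 in
    let env := collect_atoms y e1 in
    let a := reify_module x env in
    let b := reify_module y env in
    apply: (@meval_eq (CompleteNormedModule.ModuleSpace _ B) env a b);
    cbn [mcoefs_eq length mcoef Nat.eqb]; repeat split
  end.

Ltac module_ring B := compare_coefficients B; ring.

(** * Norms, lower bounds and resolvents *)

Section Norms.

Variable B : CompleteNormedModule C_AbsRing.

Lemma norm_is_norm : is_norm (@norm _ B).
Proof.
split; first exact: norm_triangle.
split; last exact: norm_eq_zero.
move=> c x; apply: Rle_antisym; first exact: (norm_scal c x).
case: (Ceq_dec c (RtoC 0)) => [->|c0].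
  rewrite Cmod_0 Rmult_0_l; exact: norm_ge_0.
have cpos : 0 < Cmod c by apply/Cmod_gt_0.
have E : x = scal (/ c)%C (scal c x).
  by compare_coefficients B; field.
have := norm_scal (/ c)%C (scal c x); rewrite -E => H.
have {}H : norm x <= / Cmod c * norm (scal c x).
  by rewrite -Cmod_inv.
have := Rmult_le_compat_l _ _ _ (Rlt_le _ _ cpos) H.
rewrite -Rmult_assoc Rinv_r; last lra.
by rewrite Rmult_1_l.
Qed.

Variables (N : B -> R) (N_norm : is_norm N).

Lemma is_norm_triangle x y : N (plus x y) <= N x + N y.
Proof. by case: N_norm. Qed.

Lemma is_norm_scal c x : N (scal c x) = Cmod c * N x.
Proof. by case: N_norm => _ []. Qed.

Lemma is_norm_zero : N zero = 0.
Proof. by rewrite -(scal_zero_r (RtoC 0)) is_norm_scal Cmod_0 Rmult_0_l. Qed.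

Lemma is_norm_opp x : N (opp x) = N x.
Proof.
have -> : opp x = scal (RtoC (-1)) x by module_ring B.
rewrite is_norm_scal Cmod_R Rabs_left; lra.
Qed.

Lemma is_norm_ge0 x : 0 <= N x.
Proof.
have := is_norm_triangle x (opp x).
by rewrite plus_opp_r is_norm_zero is_norm_opp; lra.
Qed.

Lemma is_norm_minus x y : N (minus x y) <= N x + N y.
Proof. by have := is_norm_triangle x (opp y); rewrite is_norm_opp. Qed.

Lemma is_norm_sym x y : N (minus x y) = N (minus y x).
Proof. by rewrite -is_norm_opp; congr N; module_ring B. Qed.

Lemma is_norm_split x y : N x <= N (minus x y) + N y.
Proof.
by have := is_norm_triangle (minus x y) y;
  have -> : plus (minus x y) y = x by module_ring B.
Qed.

Lemma is_norm_sum (f : nat -> B) (m : R) n :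
  (forall k, (k <= n)%nat -> N (f k) <= m) ->
  N (sum_n f n) <= INR n.+1 * m.
Proof.
elim: n => [|n IH] H; first by rewrite sum_O Rmult_1_l; apply: H.
rewrite sum_Sn S_INR Rmult_plus_distr_r Rmult_1_l.
apply: Rle_trans (is_norm_triangle _ _) _.
apply: Rplus_le_compat; last exact: H.
by apply: IH => k kn; apply: H; apply: leqW.
Qed.

End Norms.

Arguments is_norm_triangle {B N} N_norm x y.
Arguments is_norm_scal {B N} N_norm c x.
Arguments is_norm_zero {B N} N_norm.
Arguments is_norm_opp {B N} N_norm x.
Arguments is_norm_ge0 {B N} N_norm x.
Arguments is_norm_minus {B N} N_norm x y.
Arguments is_norm_sym {B N} N_norm x y.
Arguments is_norm_split {B N} N_norm x y.
Arguments is_norm_sum {B N} N_norm f m n _.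

Section LinearMaps.

Variable B : CompleteNormedModule C_AbsRing.
Implicit Types (P Q : B -> B) (z w : C).

Lemma linear_sum P (f : nat -> B) n :
  is_linear P -> P (sum_n f n) = sum_n (fun k => P (f k)) n.
Proof.
move=> PL; elim: n => [|n IH]; first by rewrite !sum_O.
by rewrite !sum_Sn (linear_plus _ PL) IH.
Qed.

Lemma is_linear_iter P n : is_linear P -> is_linear (Nat.iter n P).
Proof.
move=> PL; elim: n => [|n IH]; first exact: is_linear_id.
exact: (is_linear_comp (Nat.iter n P) P IH PL).
Qed.

Lemma iter_comm P n x : Nat.iter n P (P x) = P (Nat.iter n P x).
Proof. by elim: n => [//|n IH] /=; rewrite IH. Qed.

Lemma z_minus_linear P z : is_linear P -> is_linear (z_minus z P).
Proof.
move=> PL; split.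
- by move=> x y; rewrite /z_minus (linear_plus _ PL); module_ring B.
- by move=> k x; rewrite /z_minus (linear_scal _ PL); module_ring B.
case: (linear_norm _ PL) => L [Lpos HL].
exists (Cmod z + L); split; first by have := Cmod_ge_0 z; lra.
move=> x; apply: Rle_trans (is_norm_minus (norm_is_norm B) _ _) _.
rewrite (is_norm_scal (norm_is_norm B)); have := HL x; lra.
Qed.

Lemma iter_z_minus P z n x : is_linear P ->
  Nat.iter n P (z_minus z P x) = z_minus z P (Nat.iter n P x).
Proof.
move=> PL; have PnL := is_linear_iter P n PL.
by rewrite /z_minus (linear_minus _ _ _ PnL) (linear_scal _ PnL) iter_comm.
Qed.

(** Together with density of the range this says that [z - P] is invertible with
    inverse of norm at most [/ k]; unlike invertibility it is visibly stable
    under perturbations of [z] and of [P]. *)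
Definition bdd_below P (k : R) z : Prop :=
  forall x : B, k * norm x <= norm (z_minus z P x).

Lemma bdd_below_le P k k' z : k' <= k -> bdd_below P k z -> bdd_below P k' z.
Proof.
move=> kk H x; apply: Rle_trans (H x).
apply: Rmult_le_compat_r => //; exact: norm_ge_0.
Qed.

Lemma bdd_below_shift P k h z w :
  bdd_below P k z -> Cmod (w - z)%C <= h -> bdd_below P (k - h) w.
Proof.
move=> H Hw x.
have := is_norm_split (norm_is_norm B) (z_minus z P x) (z_minus w P x).
have -> : minus (z_minus z P x) (z_minus w P x) = scal (z - w)%C x
  by module_ring B.
rewrite (is_norm_scal (norm_is_norm B)) => H1.
have E : Cmod (z - w)%C = Cmod (w - z)%C.
  by rewrite -Cmod_opp; congr Cmod; ring.
rewrite E in H1.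
have := Rmult_le_compat_r _ _ _ (norm_ge_0 x) Hw.
have := H x; lra.
Qed.

Lemma bdd_below_inj P k z x y : is_linear P -> 0 < k -> bdd_below P k z ->
  z_minus z P x = z_minus z P y -> x = y.
Proof.
move=> PL k0 H E.
have := H (minus x y).
rewrite (linear_minus _ _ _ (z_minus_linear P z PL)) E minus_eq_zero.
rewrite norm_zero => H1.
have : norm (minus x y) = 0.
  apply: Rle_antisym; last exact: norm_ge_0.
  by apply: (Rmult_le_reg_l k) => //; rewrite Rmult_0_r.
move/norm_eq_zero => E0.
have -> : x = plus (minus x y) y by module_ring B.
by rewrite E0 plus_zero_l.
Qed.

Lemma norm_small_zero (x : B) : (forall e, 0 < e -> norm x <= e) -> x = zero.
Proof.
move=> H; apply: norm_eq_zero; apply: Rle_antisym; last exact: norm_ge_0.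
by apply: Rnot_lt_le => /Rlt_gt H0; have := H (norm x / 2); lra.
Qed.

Lemma cauchy_seq_cv (x : nat -> B) (s : nat -> R) :
  (forall e, 0 < e -> exists n0, forall n, (n0 <= n)%nat -> s n < e) ->
  (forall n m, norm (minus (x n) (x m)) <= s n + s m) ->
  exists l, forall e, 0 < e ->
    exists n0, forall n, (n0 <= n)%nat -> norm (minus (x n) l) < e.
Proof.
move=> Hs Hx.
have [l Hl] : exists l, filterlim x eventually (locally l).
  apply/filterlim_locally_cauchy => e.
  have [|n0 H0] := Hs (e / 2); first by have := cond_pos e; lra.
  exists (fun n => (n0 <= n)%nat); split; first by exists n0 => n /leP.
  move=> n m /H0 Hn /H0 Hm; apply: norm_compat1.
  by apply: Rle_lt_trans (Hx _ _) _; lra.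
exists l => e e0.
move/filterlim_locally_ball_norm: Hl => /(_ (mkposreal e e0)) [n0 H0].
by exists n0 => n /leP; apply: H0.
Qed.

(** The preimages of a sequence that approaches [y] form a Cauchy sequence. *)
Lemma bdd_below_range_closed P k z y : is_linear P -> 0 < k ->
  bdd_below P k z ->
  (forall e : posreal, exists x, norm (minus y (z_minus z P x)) < e) ->
  exists x, z_minus z P x = y.
Proof.
move=> PL k0 H D.
have pos n : 0 < / INR n.+1 by apply: Rinv_0_lt_compat; apply: lt_0_INR; lia.
have [x Hx] : exists x : nat -> B,
    forall n, norm (minus y (z_minus z P (x n))) < / INR n.+1.
  apply: (functional_choice
    (fun n x => norm (minus y (z_minus z P x)) < / INR n.+1)) => n.
  exact: (D (mkposreal _ (pos n))).
have small e : 0 < e ->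
    exists n0, forall n, (n0 <= n)%nat -> / INR n.+1 < e.
  move=> e0; have [n0 [H0 n0pos]] := archimed_cor1 e e0.
  exists n0 => n /leP Hn; apply: Rle_lt_trans H0.
  apply: Rinv_le_contravar; first by apply: lt_0_INR; lia.
  by apply: le_INR; lia.
have ZL := z_minus_linear P z PL.
have N := norm_is_norm B.
have [l Hl] : exists l, forall e, 0 < e ->
    exists n0, forall n, (n0 <= n)%nat -> norm (minus (x n) l) < e.
  apply: (cauchy_seq_cv x (fun n => / k * / INR n.+1)) => [e e0|n m].
    have [|n0 H0] := small (k * e); first exact: Rmult_lt_0_compat.
    exists n0 => n /H0 Hn; apply: (Rmult_lt_reg_l k) => //.
    by rewrite -Rmult_assoc Rinv_r ?Rmult_1_l //; lra.
  apply: (Rmult_le_reg_l k) => //.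
  apply: Rle_trans (H _) _.
  rewrite -Rmult_plus_distr_l -Rmult_assoc Rinv_r; last lra.
  rewrite Rmult_1_l (linear_minus _ _ _ ZL).
  have -> : minus (z_minus z P (x n)) (z_minus z P (x m))
      = minus (minus y (z_minus z P (x m))) (minus y (z_minus z P (x n)))
    by module_ring B.
  apply: Rle_trans (is_norm_minus N _ _) _.
  have := Hx n; have := Hx m; lra.
exists l.
case: (linear_norm _ ZL) => L [L0 HL].
have E : minus (z_minus z P l) y = zero.
  apply: norm_small_zero => e e0.
  have [|n1 H1] := small (e / 2); first lra.
  have [|n2 H2] := Hl (e / (2 * L)); first by apply: Rdiv_lt_0_compat; lra.
  pose n := maxn n1 n2.
  have {}H1 := H1 n (leq_maxl _ _); have {}H2 := H2 n (leq_maxr _ _).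
  have -> : minus (z_minus z P l) y =
      opp (plus (z_minus z P (minus (x n) l)) (minus y (z_minus z P (x n)))).
    by rewrite (linear_minus _ _ _ ZL); module_ring B.
  rewrite (is_norm_opp N).
  apply: Rle_trans (is_norm_triangle N _ _) _.
  have := HL (minus (x n) l); have := Hx n.
  have : L * norm (minus (x n) l) <= e / 2.
    have -> : e / 2 = L * (e / (2 * L)) by field; lra.
    by apply: Rmult_le_compat_l; lra.
  lra.
have -> : z_minus z P l = plus (minus (z_minus z P l) y) y by module_ring B.
by rewrite E plus_zero_l.
Qed.

Lemma not_spectrum_right P z phi : ~ spectrum P z ->
  z_minus z P (resolvent P z phi) = phi.
Proof.
move/NNPP => [Q [QL [H1 H2]]].
rewrite /resolvent (iota_unique _ (Q phi)) // => y E.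
by rewrite -(H1 y) E.
Qed.

Lemma not_spectrum_left P z phi : ~ spectrum P z ->
  resolvent P z (z_minus z P phi) = phi.
Proof.
move/NNPP => [Q [QL [H1 H2]]].
apply: iota_unique => // y E.
by rewrite -(H1 y) E.
Qed.

Lemma resolvent_linear P z : ~ spectrum P z -> is_linear (resolvent P z).
Proof.
move=> Hz; have R := not_spectrum_left P z ^~ Hz.
move/NNPP: (Hz) => [Q [QL [H1 H2]]].
have E phi : resolvent P z phi = Q phi by rewrite -{1}(H2 phi) R.
exact: is_linear_ext _ _ (fun x => esym (E x)) QL.
Qed.

Lemma resolvent_comm P z phi : is_linear P -> ~ spectrum P z ->
  resolvent P z (P phi) = P (resolvent P z phi).
Proof.
move=> PL Hz.
rewrite -{1}(not_spectrum_right P z phi Hz).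
have := iter_z_minus P z 1 (resolvent P z phi) PL => /= ->.
by rewrite not_spectrum_left.
Qed.

(** With a lower bound, [z - P] is injective with closed range, so the only way
    not to be invertible is to have a range that is not dense. *)
Lemma bdd_below_not_spectrum P k z : is_linear P -> 0 < k ->
  bdd_below P k z -> (spectrum P z -> ~ residual_spectrum P z) ->
  ~ spectrum P z.
Proof.
move=> PL k0 H NR S; apply: (NR S); split.
  by move=> x y; apply: bdd_below_inj k0 H.
move=> D; apply: S.
have [Q HQ] : exists Q : B -> B, forall y, z_minus z P (Q y) = y.
  apply: (functional_choice (fun y x => z_minus z P x = y)) => y.
  by apply: bdd_below_range_closed k0 H _.
have ZL := z_minus_linear P z PL.
have inj := bdd_below_inj P k z _ _ PL k0 H.
exists Q; split; last by split => // phi; apply: inj.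
split.
- by move=> x y; apply: inj; rewrite (linear_plus _ ZL) !HQ.
- by move=> c x; apply: inj; rewrite (linear_scal _ ZL) !HQ.
exists (/ k); split; first exact: Rinv_0_lt_compat.
move=> x; apply: (Rmult_le_reg_l k) => //.
rewrite -Rmult_assoc Rinv_r ?Rmult_1_l; last lra.
by apply: Rle_trans (H _) _; rewrite HQ; apply: Rle_refl.
Qed.

Lemma bdd_below_resolvent P z : ~ spectrum P z ->
  exists k, 0 < k /\ bdd_below P k z.
Proof.
move=> Hz; have := linear_norm _ (resolvent_linear P z Hz) => [[L [L0 HL]]].
exists (/ L); split; first exact: Rinv_0_lt_compat.
move=> x; apply: (Rmult_le_reg_l L) => //.
rewrite -Rmult_assoc Rinv_r ?Rmult_1_l; last lra.
by rewrite -{1}(not_spectrum_left P z x Hz); apply: HL.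
Qed.

(** The resolvent set, with an explicit bound on the resolvent. *)
Definition regular P (k : R) z : Prop := ~ spectrum P z /\ bdd_below P k z.

Lemma resolvent_bound P k z phi : 0 < k -> regular P k z ->
  norm (resolvent P z phi) <= / k * norm phi.
Proof.
move=> k0 [Hz H]; apply: (Rmult_le_reg_l k) => //.
rewrite -Rmult_assoc Rinv_r ?Rmult_1_l; last lra.
by apply: Rle_trans (H _) _; rewrite not_spectrum_right //; apply: Rle_refl.
Qed.

Lemma resolvent_lipschitz P k z w phi : 0 < k ->
  regular P k z -> regular P k w ->
  norm (minus (resolvent P z phi) (resolvent P w phi))
    <= Cmod (z - w)%C * (/ k * (/ k * norm phi)).
Proof.
move=> k0 Hz Hw.
have [Sz _] := Hz; have [Sw _] := Hw.
have RL := resolvent_linear P z Sz.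
(* The resolvent identity. *)
have -> : minus (resolvent P z phi) (resolvent P w phi)
    = resolvent P z (scal (w - z)%C (resolvent P w phi)).
  set u := resolvent P w phi.
  have -> : scal (w - z)%C u = minus (z_minus w P u) (z_minus z P u)
    by module_ring B.
  rewrite (linear_minus _ _ _ RL) (not_spectrum_left _ _ u Sz).
  by rewrite /u not_spectrum_right.
rewrite (linear_scal _ RL) (is_norm_scal (norm_is_norm B)).
have -> : Cmod (w - z)%C = Cmod (z - w)%C.
  by rewrite -Cmod_opp; congr Cmod; ring.
apply: Rmult_le_compat_l; first exact: Cmod_ge_0.
apply: Rle_trans (resolvent_bound P k z _ k0 Hz) _.
apply: Rmult_le_compat_l; last exact: resolvent_bound.
by apply: Rlt_le; apply: Rinv_0_lt_compat.
Qed.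

End LinearMaps.
Arguments bdd_below {B} P k z.
Arguments regular {B} P k z.

(** * Optimising the number of iterates *)

Lemma pow_small q e : 0 < q < 1 -> 0 < e -> exists n : nat, q ^ n <= e.
Proof.
move=> [q0 q1] e0.
have [|n Hn] := pow_lt_1_zero q _ e e0; first by rewrite Rabs_pos_eq; lra.
exists n; have := Hn n (le_n n); have := Rle_abs (q ^ n); lra.
Qed.

Lemma exponent_bounds theta r M : 0 < theta -> theta < r < M ->
  0 < ln (r / theta) / ln (M / theta) < 1.
Proof.
move=> t0 [tr rM].
have H1 : 1 < r / theta.
  by apply: (Rmult_lt_reg_r theta) => //; rewrite /Rdiv Rmult_assoc Rinv_l; lra.
have H2 : r / theta < M / theta.
  by apply: Rmult_lt_compat_r => //; apply: Rinv_0_lt_compat.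
have L1 : 0 < ln (r / theta) by rewrite -ln_1; apply: ln_increasing; lra.
have L2 : ln (r / theta) < ln (M / theta) by apply: ln_increasing; lra.
split; first by apply: Rdiv_lt_0_compat; lra.
apply: (Rmult_lt_reg_r (ln (M / theta))); first lra.
rewrite /Rdiv Rmult_assoc Rinv_l; lra.
Qed.

Lemma Rpower_antimono x p q : 0 < x <= 1 -> q <= p -> Rpower x p <= Rpower x q.
Proof.
move=> [x0 x1] qp; rewrite /Rpower.
have L : ln x <= 0 by rewrite -ln_1; apply: ln_le.
have H0 : p * ln x <= q * ln x by nra.
have [H|->] := Rle_lt_or_eq_dec _ _ H0; last exact: Rle_refl.
by apply: Rlt_le; apply: exp_increasing.
Qed.

Lemma rpow_ge0 x y : 0 <= rpow x y.
Proof.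
rewrite /rpow; case: (Req_EM_T x 0) => /= _; first lra.
by apply: Rlt_le; apply: exp_pos.
Qed.

Lemma rpow_small y e : 0 < y -> 0 < e ->
  exists t0, 0 < t0 /\ forall t, 0 <= t <= t0 -> rpow t y <= e.
Proof.
move=> y0 e0; exists (Rpower e (/ y)); split; first exact: exp_pos.
move=> t [t0 te]; rewrite /rpow; case: (Req_EM_T t 0) => /= [_|tn]; first lra.
have -> : e = Rpower (Rpower e (/ y)) y.
  by rewrite Rpower_mult Rinv_l ?Rpower_1 //; lra.
apply: Rle_Rpower_l; lra.
Qed.

(** The first [n] with [q ^ n <= t]. *)
Lemma balanced_iterate q t : 0 < q < 1 -> 0 < t <= 1 ->
  exists n : nat, q ^ n <= t <= q ^ n * / q.
Proof.
move=> [q0 q1] [t0 t1].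
have [n0 H0] := pow_small q t (conj q0 q1) t0.
elim: n0 H0 => [|n IH] H.
  exists 0%nat; split => //=.
  have : 1 < / q by rewrite -Rinv_1; apply: Rinv_lt_contravar; lra.
  lra.
case: (Rle_lt_dec (q ^ n) t) => Hn; first exact: IH.
exists n.+1; split => //=.
have -> : q * q ^ n * / q = q ^ n by field; lra.
lra.
Qed.

(** The number [n] of iterates is free, and the choice that balances the two
    terms is [(theta / M) ^ n ~ t], which gives [t] to the power [eta].
    Whichever of [1 / 2] and [eta / (2 * (1 - eta))] is the smaller is at most
    [eta]: the second when [eta <= 1 / 2], the first otherwise. *)
Lemma optimised_rate theta r M t E x :
  0 < theta -> theta < r < M -> 0 <= t <= 1 -> 0 <= E ->
  (forall n : nat, x <= E * ((theta / r) ^ n + (M / r) ^ n * t)) ->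
  let eta := ln (r / theta) / ln (M / theta) in
  x <= E * (1 + M / theta)
       * (rpow t (1 / 2) + rpow t (eta / (2 * (1 - eta)))).
Proof.
move=> th0 rr [t0 t1] E0 Hx eta.
have [tr rM] := rr.
have [eta0 eta1] : 0 < eta < 1 := exponent_bounds theta r M th0 rr.
have Mt : 0 < M / theta by apply: Rdiv_lt_0_compat; lra.
have q1 : 0 < theta / r < 1.
  split; first by apply: Rdiv_lt_0_compat; lra.
  apply: (Rmult_lt_reg_r r); first lra.
  rewrite /Rdiv Rmult_assoc Rinv_l; lra.
case: (Req_dec t 0) => [tz|tn].
  apply: Rle_trans (_ : 0 <= _); last first.
    have := rpow_ge0 t (1 / 2); have := rpow_ge0 t (eta / (2 * (1 - eta))).
    move=> ? ?; apply: Rmult_le_pos; last lra.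
    by apply: Rmult_le_pos; lra.
  apply: Rnot_lt_le => x0.
  have Ep : 0 < E.
    case: E0 => // Ez; have := Hx 0%nat; rewrite -Ez Rmult_0_l; lra.
  have [|n Hn] := pow_small (theta / r) (x / (2 * E)) q1.
    by apply: Rdiv_lt_0_compat; lra.
  have := Hx n; rewrite tz Rmult_0_r Rplus_0_r => H.
  have := Rmult_le_compat_l E _ _ E0 Hn.
  have -> : E * (x / (2 * E)) = x / 2 by field; lra.
  lra.
have q2 : 0 < theta / M < 1.
  split; first by apply: Rdiv_lt_0_compat; lra.
  apply: (Rmult_lt_reg_r M); first lra.
  rewrite /Rdiv Rmult_assoc Rinv_l; lra.
have tpos : 0 < t <= 1 by lra.
have [n [H1 H2]] := balanced_iterate (theta / M) t q2 tpos.
have powE : (theta / r) ^ n = Rpower ((theta / M) ^ n) eta.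
  rewrite -!Rpower_pow; try lra.
  rewrite Rpower_mult Rmult_comm -Rpower_mult; congr Rpower.
  rewrite /Rpower /eta.
  have -> : ln (theta / M) = - ln (M / theta).
    by rewrite -ln_Rinv //; congr ln; field; lra.
  have L : 0 < ln (M / theta).
    rewrite -ln_1; apply: ln_increasing; first lra.
    apply: (Rmult_lt_reg_r theta) => //.
    rewrite /Rdiv Rmult_assoc Rinv_l; lra.
  have -> : ln (r / theta) / ln (M / theta) * - ln (M / theta)
      = - ln (r / theta) by field; lra.
  rewrite -ln_Rinv; last by apply: Rdiv_lt_0_compat; lra.
  rewrite exp_ln; first by field; lra.
  by apply: Rinv_0_lt_compat; apply: Rdiv_lt_0_compat; lra.
have P1 : (theta / r) ^ n <= Rpower t eta.
  rewrite powE; apply: Rle_Rpower_l; first lra.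
  by split => //; apply: pow_lt; lra.
have P2 : (M / r) ^ n * t <= M / theta * (theta / r) ^ n.
  have -> : M / theta * (theta / r) ^ n
      = (M / r) ^ n * ((theta / M) ^ n * / (theta / M)).
    rewrite -Rmult_assoc -Rpow_mult_distr.
    have -> : M / r * (theta / M) = theta / r by field; lra.
    by field; lra.
  apply: Rmult_le_compat_l => //.
  by apply: pow_le; apply: Rlt_le; apply: Rdiv_lt_0_compat; lra.
have P3 : Rpower t eta <= rpow t (1 / 2) + rpow t (eta / (2 * (1 - eta))).
  have G1 := rpow_ge0 t (1 / 2).
  have G2 := rpow_ge0 t (eta / (2 * (1 - eta))).
  case: (Rle_lt_dec eta (1 / 2)) => He.
    apply: Rle_trans (_ : rpow t (eta / (2 * (1 - eta))) <= _); last lra.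
    rewrite /rpow; case: (Req_EM_T t 0) => //= _; apply: Rpower_antimono => //.
    apply: (Rmult_le_reg_r (2 * (1 - eta))); first lra.
    rewrite /Rdiv Rmult_assoc Rinv_l; last lra.
    nra.
  apply: Rle_trans (_ : rpow t (1 / 2) <= _); last lra.
  by rewrite /rpow; case: (Req_EM_T t 0) => //= _; apply: Rpower_antimono; lra.
apply: Rle_trans (Hx n) _; rewrite Rmult_assoc.
apply: Rmult_le_compat_l => //.
have P4 : (theta / r) ^ n * (1 + M / theta)
    <= (1 + M / theta) * (rpow t (1 / 2) + rpow t (eta / (2 * (1 - eta)))).
  rewrite Rmult_comm; apply: Rmult_le_compat_l; lra.
lra.
Qed.

(** * The perturbation estimates *)

Section Estimates.

Variable B : CompleteNormedModule C_AbsRing.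
Variables (nw : B -> R) (nw_norm : is_norm nw).
Variables (C M theta : R).
Hypotheses (C_ge1 : 1 <= C) (theta_pos : 0 < theta).
Hypothesis nw_le : forall phi : B, nw phi <= C * norm phi.
Implicit Types (P Q : B -> B) (z : Complex.C).

(** The iterate of order zero is included, which requires [1 <= C]. *)
Definition lasota_yorke P : Prop :=
  is_linear P /\
  (forall n phi, nw (Nat.iter n P phi) <= C * M ^ n * nw phi) /\
  (forall n phi, norm (Nat.iter n P phi)
     <= C * theta ^ n * norm phi + C * M ^ n * nw phi).

(** Iterating [z phi = P phi + psi] bounds [phi] by [P^n phi] and by the partial
    sums of two geometric series of ratios [s / r < 1] and [t / r > 1]. *)
Lemma telescoping (N : B -> R) P z r s t al be phi n :
  is_norm N -> is_linear P ->
  0 < s -> s < r -> r < t -> r <= Cmod z -> 0 <= al -> 0 <= be ->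
  (forall k, N (Nat.iter k P (z_minus z P phi)) <= al * s ^ k + be * t ^ k) ->
  N phi <= / r ^ n * N (Nat.iter n P phi)
           + al / (r - s) + be / (t - r) * (t / r) ^ n.
Proof.
move=> NN PL s0 sr rt rz al0 be0 H.
have r0 : 0 < r by lra.
suff: N phi <= / r ^ n * N (Nat.iter n P phi)
     + al / (r - s) * (1 - (s / r) ^ n) + be / (t - r) * ((t / r) ^ n - 1).
  have X1 : 0 <= al / (r - s) * (s / r) ^ n.
    apply: Rmult_le_pos; first by apply: Rdiv_le_0_compat; lra.
    by apply: pow_le; apply: Rdiv_le_0_compat; lra.
  have X2 : 0 <= be / (t - r) by apply: Rdiv_le_0_compat; lra.
  lra.
elim: n => [|n IH] /=; first by rewrite Rinv_1; lra.
have rn : 0 < r ^ n by apply: pow_lt.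
apply: Rle_trans IH _.
have step : r * N (Nat.iter n P phi)
    <= N (P (Nat.iter n P phi)) + (al * s ^ n + be * t ^ n).
  have := H n; rewrite iter_z_minus // => Hn.
  have Nz : Cmod z * N (Nat.iter n P phi)
      <= N (P (Nat.iter n P phi))
         + N (z_minus z P (Nat.iter n P phi)).
    rewrite -(is_norm_scal NN).
    apply: Rle_trans (is_norm_triangle NN _ _).
    by apply: Req_le; congr N; module_ring B.
  have := Rmult_le_compat_r _ _ _ (is_norm_ge0 NN (Nat.iter n P phi)) rz.
  lra.
have E1 : / r ^ n * N (Nat.iter n P phi)
    = / (r * r ^ n) * (r * N (Nat.iter n P phi)) by field; lra.
rewrite E1.
have rrn : 0 <= / (r * r ^ n).
  by apply: Rlt_le; apply: Rinv_0_lt_compat; apply: Rmult_lt_0_compat.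
have {}step := Rmult_le_compat_l _ _ _ rrn step.
apply: Rle_trans (Rplus_le_compat_r _ _ _ (Rplus_le_compat_r _ _ _ step)) _.
have E (x : R) : (x / r) ^ n = x ^ n / r ^ n.
  by rewrite /Rdiv Rpow_mult_distr pow_inv.
rewrite !E; apply: Req_le; field; lra.
Qed.

Lemma iter_bdd_below P k z n phi : is_linear P -> bdd_below P k z ->
  k * norm (Nat.iter n P phi) <= norm (Nat.iter n P (z_minus z P phi)).
Proof. by move=> PL H; rewrite iter_z_minus. Qed.

Lemma div_pow (x y : R) n : (x / y) ^ n = / y ^ n * x ^ n.
Proof. by rewrite /Rdiv Rpow_mult_distr pow_inv Rmult_comm. Qed.

(** Since [P^n] commutes with [z - P], the lower bound turns the Banach norm of
    [P^n phi] into that of [P^n (z phi - P phi)], to which the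
    Lasota-Yorke inequality applies; so no weak norm of [phi] is left. *)
Lemma weak_estimate P k z r phi n :
  lasota_yorke P -> theta < r < M -> r <= Cmod z -> 0 < k -> bdd_below P k z ->
  nw phi <= (C * C / k + C / (M - r)) *
    ((theta / r) ^ n * norm (z_minus z P phi)
     + (M / r) ^ n * nw (z_minus z P phi)).
Proof.
move=> [PL [HM Hth]] [tr rM] rz k0 Hk.
set psi := z_minus z P phi.
have r0 : 0 < r by lra.
have psi0 := is_norm_ge0 nw_norm psi.
have psin := norm_ge_0 psi.
have T : nw phi <= / r ^ n * nw (Nat.iter n P phi)
    + 0 / (r - theta) + C * nw psi / (M - r) * (M / r) ^ n.
  apply: telescoping rz _ _ _ => //; try lra.
    by apply: Rmult_le_pos => //; lra.
  by move=> j; have := HM j psi; rewrite -/psi; lra.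
have W : nw (Nat.iter n P phi)
    <= C / k * (C * theta ^ n * norm psi + C * M ^ n * nw psi).
  apply: Rle_trans (nw_le _) _.
  rewrite /Rdiv Rmult_assoc; apply: Rmult_le_compat_l; first lra.
  apply: (Rmult_le_reg_l k) => //.
  rewrite -Rmult_assoc Rinv_r ?Rmult_1_l; last lra.
  by apply: Rle_trans (iter_bdd_below P k z n phi PL Hk) _; exact: Hth.
have rn : 0 < / r ^ n by apply: Rinv_0_lt_compat; apply: pow_lt.
have {}W := Rmult_le_compat_l _ _ _ (Rlt_le _ _ rn) W.
have Y : 0 <= C / (M - r) * ((theta / r) ^ n * norm psi).
  apply: Rmult_le_pos; first by apply: Rdiv_le_0_compat; lra.
  apply: Rmult_le_pos => //; apply: pow_le; apply: Rdiv_le_0_compat; lra.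
apply: Rle_trans T _.
have -> : 0 / (r - theta) = 0 by field; lra.
have Ew : / r ^ n * (C / k * (C * theta ^ n * norm psi + C * M ^ n * nw psi))
  = C * C / k * ((theta / r) ^ n * norm psi + (M / r) ^ n * nw psi).
  by rewrite !div_pow; field; split; [apply: pow_nonzero|]; lra.
rewrite Ew in W.
have -> : C * nw psi / (M - r) * (M / r) ^ n
  = C / (M - r) * ((M / r) ^ n * nw psi) by field; lra.
lra.
Qed.

Lemma strong_estimate P z r phi n :
  lasota_yorke P -> theta < r < M -> r <= Cmod z ->
  norm phi <= C * (theta / r) ^ n * norm phi + C * (M / r) ^ n * nw phi
    + C / (r - theta) * norm (z_minus z P phi)
    + C / (M - r) * (M / r) ^ n * nw (z_minus z P phi).
Proof.
move=> [PL [HM Hth]] [tr rM] rz.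
set psi := z_minus z P phi.
have r0 : 0 < r by lra.
have T : norm phi <= / r ^ n * norm (Nat.iter n P phi)
    + C * norm psi / (r - theta) + C * nw psi / (M - r) * (M / r) ^ n.
  apply: telescoping rz _ _ _ => //; try lra.
  - exact: norm_is_norm.
  - by apply: Rmult_le_pos; [lra | exact: norm_ge_0].
  - by apply: Rmult_le_pos; [lra | exact: is_norm_ge0].
  by move=> j; have := Hth j psi; rewrite -/psi; lra.
have rn : 0 < / r ^ n by apply: Rinv_0_lt_compat; apply: pow_lt.
have W := Rmult_le_compat_l _ _ _ (Rlt_le _ _ rn) (Hth n phi).
apply: Rle_trans T _; rewrite !div_pow.
have -> : C * norm psi / (r - theta) = C / (r - theta) * norm psi
  by field; lra.
have -> : C * nw psi / (M - r) * (/ r ^ n * M ^ n)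
  = C / (M - r) * (/ r ^ n * M ^ n) * nw psi by field; split;
    [apply: pow_nonzero|]; lra.
lra.
Qed.

Lemma lasota_yorke_diff P Q phi : lasota_yorke P -> lasota_yorke Q ->
  norm (minus (P phi) (Q phi)) <= 2 * C * (theta + M * C) * norm phi.
Proof.
move=> [_ [HMP HP]] [_ [HMQ HQ]].
have M0 : 0 <= M * nw phi.
  have := HMP 1%nat phi; rewrite /= Rmult_1_r => H.
  have := is_norm_ge0 nw_norm (P phi) => H0.
  apply: (Rmult_le_reg_l C); first lra.
  rewrite Rmult_0_r; lra.
apply: Rle_trans (is_norm_minus (norm_is_norm B) _ _) _.
have := HP 1%nat phi; have := HQ 1%nat phi; rewrite /= !Rmult_1_r => H1 H2.
apply: Rle_trans (Rplus_le_compat _ _ _ _ H2 H1) _.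
have n0 := norm_ge_0 phi; have w0 := is_norm_ge0 nw_norm phi.
case: (Rle_lt_dec 0 M) => Ms.
  have : C * M * nw phi <= C * M * (C * norm phi).
    by apply: Rmult_le_compat_l => //; apply: Rmult_le_pos; lra.
  lra.
have wz : nw phi = 0 by nra.
have -> : norm phi = 0.
  case: nw_norm => _ [_ Z]; rewrite (Z _ wz); exact: norm_zero.
by rewrite wz; lra.
Qed.

(** The factor [a] of the Banach norm must not depend on [k]. The strong estimate
    costs a weak norm of [phi], which the weak estimate for the unperturbed
    operator bounds; there a large number of iterates makes the coefficient of
    the Banach norm as small as desired, and [k] only enters that number. *)
Lemma stability r : theta < r < M ->
  exists a, 0 < a /\ forall k, 0 < k ->
  exists t0 b, 0 < t0 /\ 0 < b /\
  forall P Q, lasota_yorke P -> lasota_yorke Q ->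
    (forall phi, nw (minus (P phi) (Q phi)) <= t0 * norm phi) ->
  forall z, r <= Cmod z -> bdd_below P k z ->
  forall phi, norm phi <= a * norm (z_minus z Q phi) + b * nw (z_minus z Q phi).
Proof.
move=> rr; have [tr rM] := rr.
have r0 : 0 < r by lra.
have q1 : 0 < theta / r < 1.
  split; first by apply: Rdiv_lt_0_compat; lra.
  apply: (Rmult_lt_reg_r r) => //; rewrite /Rdiv Rmult_assoc Rinv_l; lra.
have [|m Hm] := pow_small (theta / r) (/ (2 * C)) q1.
  by apply: Rinv_0_lt_compat; lra.
have Mr n : 0 < (M / r) ^ n.
  by apply: pow_lt; apply: Rdiv_lt_0_compat; lra.
set A := 2 * C / (r - theta).
have A0 : 0 < A by apply: Rdiv_lt_0_compat; lra.
set D1 := 2 * C * (M / r) ^ m.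
have D10 : 0 < D1 by apply: Rmult_lt_0_compat; [lra | exact: Mr].
set B1 := 2 * C / (M - r) * (M / r) ^ m.
have B10 : 0 < B1.
  by apply: Rmult_lt_0_compat; [apply: Rdiv_lt_0_compat; lra | exact: Mr].
set c2 := 2 * C * (theta + M * C).
have c20 : 0 < c2.
  apply: Rmult_lt_0_compat; first lra.
  have : 0 < M * C by apply: Rmult_lt_0_compat; lra.
  lra.
exists (2 * (A + 1)); split; first lra.
move=> k k0.
set D := C * C / k + C / (M - r).
have D0 : 0 < D.
  apply: Rplus_lt_0_compat; last by apply: Rdiv_lt_0_compat; lra.
  by apply: Rdiv_lt_0_compat => //; nra.
have [|n Hn] := pow_small (theta / r) (Rmin 1 (/ (4 * c2)) / (D1 * D)) q1.
  apply: Rdiv_lt_0_compat; last exact: Rmult_lt_0_compat.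
  by apply: Rmin_pos; [lra | apply: Rinv_0_lt_compat; lra].
set e := D * (theta / r) ^ n.
have e0 : 0 <= e.
  by apply: Rmult_le_pos; [lra | apply: pow_le; lra].
have D1e : D1 * e <= Rmin 1 (/ (4 * c2)).
  have DD : 0 < D1 * D by apply: Rmult_lt_0_compat.
  have := Rmult_le_compat_l _ _ _ (Rlt_le _ _ DD) Hn.
  have -> : D1 * D * (Rmin 1 (/ (4 * c2)) / (D1 * D)) = Rmin 1 (/ (4 * c2))
    by field; lra.
  by rewrite /e -Rmult_assoc.
have D1e1 : D1 * e <= 1 by apply: Rle_trans D1e (Rmin_l _ _).
have D1e2 : D1 * e * c2 <= / 4.
  have := Rmult_le_compat_r _ _ _ (Rlt_le _ _ c20)
    (Rle_trans _ _ _ D1e (Rmin_r _ _)).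
  by have -> : / (4 * c2) * c2 = / 4 by field; lra.
set c := D * (M / r) ^ n.
have c0 : 0 < c by apply: Rmult_lt_0_compat.
have Dc : 0 < D1 * c by apply: Rmult_lt_0_compat.
exists (/ (4 * (D1 * c))), (2 * (B1 + D1 * c)).
split; first by apply: Rinv_0_lt_compat; lra.
split; first lra.
move=> P Q LP LQ PQ z rz Hk phi.
set psi := z_minus z Q phi.
have W := weak_estimate P k z r phi n LP rr rz k0 Hk.
have chiE : z_minus z P phi = minus psi (minus (P phi) (Q phi)).
  by rewrite /psi; module_ring B.
have W1 : norm (z_minus z P phi) <= norm psi + c2 * norm phi.
  rewrite chiE; apply: Rle_trans (is_norm_minus (norm_is_norm B) _ _) _.
  by have := lasota_yorke_diff P Q phi LP LQ; rewrite -/c2; lra.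
have W2 : nw (z_minus z P phi) <= nw psi + / (4 * (D1 * c)) * norm phi.
  rewrite chiE; apply: Rle_trans (is_norm_minus nw_norm _ _) _.
  by have := PQ phi; lra.
have S := strong_estimate Q z r phi m LQ rr rz; rewrite -/psi in S.
have n0 := norm_ge_0 phi; have psi0 := norm_ge_0 psi.
have H1 : C * (theta / r) ^ m * norm phi <= / 2 * norm phi.
  apply: Rmult_le_compat_r => //.
  have -> : / 2 = C * / (2 * C) by field; lra.
  by apply: Rmult_le_compat_l; lra.
have H2 : D1 * nw phi <= norm psi + / 4 * norm phi
    + D1 * c * nw psi + / 4 * norm phi.
  have := Rmult_le_compat_l _ _ _ e0 W1.
  have := Rmult_le_compat_l _ _ _ (Rlt_le _ _ c0) W2.
  move=> X1 X2.
  have X3 : nw phi <= e * (norm psi + c2 * norm phi)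
      + c * (nw psi + / (4 * (D1 * c)) * norm phi).
    by apply: Rle_trans W _; rewrite -/D; move: X1 X2; rewrite /e /c; lra.
  have := Rmult_le_compat_l _ _ _ (Rlt_le _ _ D10) X3.
  have -> : D1 * (e * (norm psi + c2 * norm phi)
      + c * (nw psi + / (4 * (D1 * c)) * norm phi))
    = D1 * e * norm psi + D1 * e * c2 * norm phi + D1 * c * nw psi
      + / 4 * norm phi by field; lra.
  have := Rmult_le_compat_r _ _ _ psi0 D1e1.
  have := Rmult_le_compat_r _ _ _ n0 D1e2.
  lra.
have E1 : C * (M / r) ^ m * nw phi = / 2 * (D1 * nw phi) by rewrite /D1; lra.
have E2 : C / (r - theta) * norm psi = / 2 * (A * norm psi).
  by rewrite /A; field; lra.
have E3 : C / (M - r) * (M / r) ^ m * nw psi = / 2 * (B1 * nw psi).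
  by rewrite /B1; field; lra.
rewrite E1 E2 E3 in S.
have := Rmult_le_pos _ _ (Rlt_le _ _ A0) psi0.
have := is_norm_ge0 nw_norm psi.
nra.
Qed.

(** The difference [u] of the two solutions satisfies
    [z u - Q u = Q phi - P phi], whose weak norm is of order [t], and the weak
    estimate for [Q] applies to [u] with any number of iterates. *)
Lemma resolvent_rate r : theta < r < M ->
  let eta := ln (r / theta) / ln (M / theta) in
  forall k, 0 < k -> exists K, 0 < K /\
  forall P Q t, lasota_yorke P -> lasota_yorke Q -> 0 <= t <= 1 ->
    (forall phi, nw (minus (P phi) (Q phi)) <= t * norm phi) ->
  forall z, r <= Cmod z -> bdd_below P k z -> bdd_below Q k z ->
  forall phi phi', z_minus z P phi = z_minus z Q phi' ->
  nw (minus phi' phi) <=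
    K * (rpow t (1 / 2) + rpow t (eta / (2 * (1 - eta))))
      * norm (z_minus z P phi).
Proof.
move=> rr eta k k0; have [tr rM] := rr.
set D := C * C / k + C / (M - r).
have D0 : 0 < D.
  apply: Rplus_lt_0_compat; last by apply: Rdiv_lt_0_compat; lra.
  by apply: Rdiv_lt_0_compat => //; nra.
set c2 := 2 * C * (theta + M * C).
have c20 : 0 < c2.
  apply: Rmult_lt_0_compat; first lra.
  have : 0 < M * C by apply: Rmult_lt_0_compat; lra.
  lra.
have Mt : 0 < M / theta by apply: Rdiv_lt_0_compat; lra.
set K0 := D / k * (c2 + 1).
have K00 : 0 < K0.
  by apply: Rmult_lt_0_compat; [apply: Rdiv_lt_0_compat|]; lra.
exists (K0 * (1 + M / theta)); split; first by apply: Rmult_lt_0_compat; lra.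
move=> P Q t LP LQ tt PQ z rz HP HQ phi phi' E.
set chi := z_minus z P phi.
have chi0 := norm_ge_0 chi.
have -> : K0 * (1 + M / theta)
    * (rpow t (1 / 2) + rpow t (eta / (2 * (1 - eta)))) * norm chi
  = (K0 * norm chi) * (1 + M / theta)
    * (rpow t (1 / 2) + rpow t (eta / (2 * (1 - eta)))) by ring.
apply: optimised_rate => //; first by apply: Rmult_le_pos; lra.
move=> n.
have QL : is_linear Q by case: LQ.
set psi := minus (Q phi) (P phi).
have psiE : z_minus z Q (minus phi' phi) = psi.
  rewrite (linear_minus _ _ _ (z_minus_linear _ Q z QL)) -E /psi.
  by module_ring B.
have W := weak_estimate Q k z r (minus phi' phi) n LQ rr rz k0 HQ.
rewrite psiE -/D in W.
have kphi : norm phi <= / k * norm chi.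
  apply: (Rmult_le_reg_l k) => //.
  rewrite -Rmult_assoc Rinv_r ?Rmult_1_l; last lra.
  exact: HP.
have psin : norm psi <= c2 * norm phi by apply: lasota_yorke_diff.
have psiw : nw psi <= t * norm phi.
  by rewrite /psi (is_norm_sym nw_norm); apply: PQ.
have q0 : 0 <= (theta / r) ^ n.
  by apply: pow_le; apply: Rdiv_le_0_compat; lra.
have q1 : 0 <= (M / r) ^ n by apply: pow_le; apply: Rdiv_le_0_compat; lra.
have n0 := norm_ge_0 phi.
apply: Rle_trans W _.
rewrite /K0.
have X1 : (theta / r) ^ n * norm psi
    <= (theta / r) ^ n * (c2 + 1) * (/ k * norm chi).
  rewrite Rmult_assoc; apply: Rmult_le_compat_l => //.
  apply: Rle_trans psin _; nra.
have X2 : (M / r) ^ n * nw psi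
    <= (M / r) ^ n * t * (c2 + 1) * (/ k * norm chi).
  rewrite !Rmult_assoc; apply: Rmult_le_compat_l => //.
  apply: Rle_trans psiw _; apply: Rmult_le_compat_l; [lra | nra].
have := Rmult_le_compat_l _ _ _ (Rlt_le _ _ D0) (Rplus_le_compat _ _ _ _ X1 X2).
have -> : D * ((theta / r) ^ n * (c2 + 1) * (/ k * norm chi)
    + (M / r) ^ n * t * (c2 + 1) * (/ k * norm chi))
  = D / k * (c2 + 1) * norm chi * ((theta / r) ^ n + (M / r) ^ n * t)
  by field; lra.
exact.
Qed.

End Estimates.
Arguments lasota_yorke {B} nw C M theta P.

(** * Uniform bounds by compactness *)

Lemma Cmod_sym (z w : C) : Cmod (z - w)%C = Cmod (w - z)%C.
Proof. by rewrite -Cmod_opp; congr Cmod; ring. Qed.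

Lemma Cmod_dist_triangle (a b c : C) :
  Cmod (a - c)%C <= Cmod (a - b)%C + Cmod (b - c)%C.
Proof. by have := Cmod_triangle (a - b) (b - c); congr (Cmod _ <= _); ring. Qed.

Lemma Cmod_minus_ge (z w : C) : Cmod z - Cmod w <= Cmod (z - w)%C.
Proof.
have := Cmod_triangle (z - w) w.
have -> : (z - w + w = z)%C by ring.
lra.
Qed.

(** Compactness for a property that is monotone in its constant: if a constant
    exists locally near every point, one exists for a whole disk. *)
Lemma uniform_on_disk (Q : C -> R -> Prop) :
  (forall z k k', k' <= k -> Q z k -> Q z k') ->
  (forall z, exists e k, 0 < e /\ 0 < k /\
     forall w, Cmod (w - z)%C < e -> Q w k) ->
  forall L, exists k, 0 < k /\ forall z, Cmod z <= L -> Q z k.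
Proof.
move=> mono loc L.
have [d Hd] : exists d : C -> posreal, forall z w,
    Cmod (w - z)%C < 2 * d z -> Q w (d z).
  apply: (functional_choice (fun z (d : posreal) => forall w,
    Cmod (w - z)%C < 2 * d -> Q w d)) => z.
  have [e [k [e0 [k0 H]]]] := loc z.
  have d0 : 0 < Rmin (e / 2) k by apply: Rmin_pos; lra.
  exists (mkposreal _ d0) => w /= Hw.
  apply: (mono _ k); first exact: Rmin_r.
  by apply: H; have := Rmin_l (e / 2) k; lra.
have [[k k0] Hk] := compactness_value_2d (- L) L (- L) L (fun u v => d (u, v)).
exists k; split => // z Hz.
apply: NNPP => HQ.
have := Rmax_Cmod z => Hmax.
have b1 : - L <= z.1 <= L.
  by apply/Rabs_le_between; have := Rmax_l (Rabs z.1) (Rabs z.2); lra.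
have b2 : - L <= z.2 <= L.
  by apply/Rabs_le_between; have := Rmax_r (Rabs z.1) (Rabs z.2); lra.
apply: (Hk z.1 z.2 b1 b2) => [[u [v [_ [_ [H1 [H2 H3]]]]]]].
apply: HQ; apply: (mono _ _ _ H3); apply: Hd.
apply: Rle_lt_trans (Cmod_2Rmax _) _.
have s2 : sqrt 2 <= 2.
  have -> : 2 = sqrt (2 * 2) by rewrite sqrt_square; lra.
  by apply: sqrt_le_1_alt; rewrite sqrt_square; lra.
have m0 : 0 <= Rmax (Rabs (z - (u, v))%C.1) (Rabs (z - (u, v))%C.2).
  by apply: Rle_trans (Rmax_l _ _); apply: Rabs_pos.
have m1 : Rmax (Rabs (z - (u, v))%C.1) (Rabs (z - (u, v))%C.2) < d (u, v).
  by apply: Rmax_lub_lt.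
have := Rmult_le_compat_r _ _ _ m0 s2; lra.
Qed.

Section UniformLowerBounds.

Variable B : CompleteNormedModule C_AbsRing.
Variables (P : B -> B) (P_linear : is_linear P).

Lemma bdd_below_far : exists L, 0 < L /\
  (forall z, L <= Cmod z -> bdd_below P 1 z) /\
  (forall z, eigenvalue P z -> Cmod z <= L).
Proof.
have [L [L0 HL]] := linear_norm _ P_linear.
have N := norm_is_norm B.
exists (L + 1); split; first lra.
split=> z.
  move=> Hz x.
  have := is_norm_triangle N (z_minus z P x) (P x).
  have -> : plus (z_minus z P x) (P x) = scal z x by module_ring B.
  rewrite (is_norm_scal N) => H.
  have := Rmult_le_compat_r _ _ _ (norm_ge_0 x) Hz; have := HL x; lra.
case=> x [xn E].
have := HL x; rewrite E (is_norm_scal N) => H.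
have x0 : 0 < norm x.
  case: (norm_ge_0 x) => // /esym /norm_eq_zero E0; by case: xn.
have := Rmult_le_reg_r _ _ _ x0 H; lra.
Qed.

(** Regularity at a point persists nearby, so compactness gives one constant for
    the bounded part of [S]; far away the norm of [P] gives a lower bound. *)
Lemma uniform_bdd_below (S : C -> Prop) :
  (forall z, ~ S z -> exists e, 0 < e /\ forall w, Cmod (w - z)%C < e -> ~ S w) ->
  (forall z, S z -> ~ spectrum P z) ->
  exists k, 0 < k /\ forall z, S z -> bdd_below P k z.
Proof.
move=> Sclosed Sres.
have [L [L0 [HL _]]] := bdd_below_far.
have [k [k0 Hk]] : exists k, 0 < k /\
    forall z, Cmod z <= L -> S z -> bdd_below P k z.
  apply: (uniform_on_disk (fun z k => S z -> bdd_below P k z)).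
    by move=> z k k' kk H /H; apply: bdd_below_le.
  move=> z; case: (classic (S z)) => Hz.
    have [k [k0 Hk]] := bdd_below_resolvent _ P z (Sres z Hz).
    exists (k / 2), (k / 2); split; first lra.
    split; first lra.
    move=> w Hw _.
    have -> : k / 2 = k - k / 2 by lra.
    by apply: bdd_below_shift Hk _; apply: Rlt_le.
  have [e [e0 He]] := Sclosed z Hz.
  by exists e, 1; split => //; split; [lra | move=> w /He].
exists (Rmin 1 k); split; first by apply: Rmin_pos; lra.
move=> z Hz; case: (Rle_lt_dec L (Cmod z)) => H.
  by apply: bdd_below_le (HL z H); apply: Rmin_l.
apply: bdd_below_le (Hk z (Rlt_le _ _ H) Hz); apply: Rmin_r.
Qed.

Lemma annulus_bdd_below c s1 s2 :
  (forall z, s1 <= Cmod (z - c)%C <= s2 -> ~ spectrum P z) ->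
  exists k, 0 < k /\
    forall z, s1 <= Cmod (z - c)%C <= s2 -> bdd_below P k z.
Proof.
apply: uniform_bdd_below => z Hz.
case: (Rlt_le_dec (Cmod (z - c)%C) s1) => H1.
  exists (s1 - Cmod (z - c)%C); split; first lra.
  by move=> w Hw [H2 _]; have := Cmod_dist_triangle w z c; lra.
case: (Rlt_le_dec s2 (Cmod (z - c)%C)) => H2; last by case: Hz.
exists (Cmod (z - c)%C - s2); split; first lra.
move=> w Hw [_ H3]; have := Cmod_dist_triangle z w c.
by rewrite (Cmod_sym z w); lra.
Qed.

Lemma V_regionE delta r z : V_region P delta r z <->
  Cmod z < r \/ exists w, spectrum P w /\ Cmod (z - w)%C < delta.
Proof.
rewrite /V_region /dist_to_set.
set E := fun x => exists w, spectrum P w /\ x = Cmod (z - w)%C.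
have [lb glb] := Glb_Rbar_correct E.
split=> [[H|H]|[H|[w [Sw H]]]]; first by left.
- right; apply: NNPP => H0.
  have : Rbar_le delta (Glb_Rbar E).
    apply: glb => x [w [Sw ->]] /=; apply: Rnot_lt_le => H1.
    by apply: H0; exists w.
  by move/Rbar_le_not_lt; apply.
- by left.
right; apply: Rbar_le_lt_trans (_ : Rbar_lt (Cmod (z - w)%C) delta) => //.
by apply: lb; exists w.
Qed.

Lemma V_region_bdd_below delta r : 0 < delta ->
  exists k, 0 < k /\ forall z, ~ V_region P delta r z -> bdd_below P k z.
Proof.
move=> d0; apply: uniform_bdd_below => z Hz.
  move/NNPP/V_regionE: Hz => [H|[w0 [S0 H]]].
    exists (r - Cmod z); split; first lra.
    move=> w Hw; apply; apply/V_regionE; left.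
    have := Cmod_minus_ge w z; lra.
  exists (delta - Cmod (z - w0)%C); split; first lra.
  move=> w Hw; apply; apply/V_regionE; right; exists w0; split => //.
  have := Cmod_dist_triangle w z w0; lra.
move=> Sz; apply: Hz; apply/V_regionE; right; exists z; split => //.
have -> : (z - z = 0)%C by ring.
by rewrite Cmod_0.
Qed.

(** Two such [lambda] are at distance at least [delta], so every disk of radius
    [delta / 2] contains at most one of them, and compactness yields a constant
    that serves them all. The inner radius keeps the inner circle outside the
    disk of radius [r], which the outer circle may enter. *)
Lemma isolated_annuli_bdd_below delta r : 0 < delta ->
  exists k, 0 < k /\ forall lambda,
    eigenvalue P lambda -> r < Cmod lambda ->
    (forall z, spectrum P z /\ Cmod (z - lambda)%C < delta <-> z = lambda) ->
    (forall z, Cmod (z - lambda)%C = delta -> ~ spectrum P z) ->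
  exists rho, 0 < rho < delta /\ rho <= Cmod lambda - r /\
    forall z, rho <= Cmod (z - lambda)%C <= delta -> bdd_below P k z.
Proof.
move=> d0; have [L [L0 [_ HL]]] := bdd_below_far.
pose G lambda := r < Cmod lambda /\
    (forall z, spectrum P z /\ Cmod (z - lambda)%C < delta <-> z = lambda) /\
    (forall z, Cmod (z - lambda)%C = delta -> ~ spectrum P z).
pose A lambda k := exists rho, 0 < rho < delta /\ rho <= Cmod lambda - r /\
    forall z, rho <= Cmod (z - lambda)%C <= delta -> bdd_below P k z.
have [k [k0 Hk]] : exists k, 0 < k /\
    forall l, Cmod l <= L -> G l -> A l k.
  apply: (uniform_on_disk (fun l k => G l -> A l k)).
    move=> z k k' kk H /H [rho [H1 [H2 H3]]]; exists rho; do 2!split => //.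
    by move=> w /H3; apply: bdd_below_le.
  move=> p.
  case: (classic (exists l, G l /\ Cmod (l - p)%C < delta / 2)); last first.
    move=> H; exists (delta / 2), 1; split; first lra.
    split; first lra.
    by move=> w Hw Gw; case: H; exists w.
  move=> [l [[rl [isol circ]] lp]].
  pose rho := Rmin (delta / 2) (Cmod l - r).
  have rho0 : 0 < rho by apply: Rmin_pos; lra.
  have rho1 : rho <= delta / 2 by apply: Rmin_l.
  have rho2 : rho <= Cmod l - r by apply: Rmin_r.
  have [z Hz|k [k0 Hk]] := annulus_bdd_below l rho delta.
    case: (Req_dec (Cmod (z - l)%C) delta) => [|nd Sz]; first exact: circ.
    have /isol E : spectrum P z /\ Cmod (z - l)%C < delta by split => //; lra.
    move: Hz; rewrite E.
    have -> : (l - l = 0)%C by ring.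
    rewrite Cmod_0; lra.
  exists (delta / 2), k; split; first lra.
  split => // w Hw [rw [isolw circw]].
  have Sw : spectrum P w by case: (proj2 (isolw w) erefl).
  have -> : w = l.
    apply/isol; split => //; rewrite (Cmod_sym l p) in lp.
    have := Cmod_dist_triangle w p l; lra.
  by exists rho; split; first lra.
by exists k; split => // l /HL ll H1 H2 H3; apply: Hk.
Qed.

End UniformLowerBounds.

(** * Roots of unity *)

Definition cis (t : R) : C := (cos t, sin t).

Lemma cisD s t : cis (s + t) = (cis s * cis t)%C.
Proof. by rewrite /cis cos_plus sin_plus /Cmult /=; congr pair; ring. Qed.

Lemma Cmod_cis t : Cmod (cis t) = 1.
Proof.
rewrite /Cmod /cis /= !Rmult_1_r.
have := sin2_cos2 t; rewrite /Rsqr => H.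
have -> : cos t * cos t + sin t * sin t = 1 by lra.
exact: sqrt_1.
Qed.

Lemma cis_pow t k : (cis t ^ k)%C = cis (INR k * t).
Proof.
elim: k => [|k IH] /=; first by rewrite Rmult_0_l /cis cos_0 sin_0.
rewrite IH -cisD; congr cis.
by case: k {IH} => [|k] /=; ring.
Qed.

Lemma cis_2PI : cis (2 * PI) = RtoC 1.
Proof. by rewrite /cis cos_2PI sin_2PI. Qed.

Lemma cis_neq1 t : 0 < t < 2 * PI -> cis t <> RtoC 1.
Proof.
move=> [t0 t1] [c1 s0].
case: (sin_eq_O_2PI_0 t) => //; try lra.
case=> H; first by move: c1; rewrite H cos_PI; lra.
lra.
Qed.

Lemma cis_lipschitz s t : Cmod (cis t - cis s)%C <= 2 * Rabs (t - s).
Proof.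
have Hc : Rabs (cos t - cos s) <= 1 * Rabs (t - s).
  apply: (bounded_variation cos (fun x => - sin x)) => x _.
  split; first by auto_derive => //; ring.
  by rewrite Rabs_Ropp; apply: Rabs_le; have := SIN_bound x; lra.
have Hs : Rabs (sin t - sin s) <= 1 * Rabs (t - s).
  apply: (bounded_variation sin (fun x => cos x)) => x _.
  split; first by auto_derive => //; ring.
  by apply: Rabs_le; have := COS_bound x; lra.
apply: Rle_trans (Cmod_2Rmax _) _ => /=.
have s2 : sqrt 2 <= 2.
  have -> : 2 = sqrt (2 * 2) by rewrite sqrt_square; lra.
  by apply: sqrt_le_1_alt; rewrite sqrt_square; lra.
apply: Rmult_le_compat => //; first exact: sqrt_pos.
  by apply: Rle_trans (Rmax_l _ _); apply: Rabs_pos.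
by rewrite !Rmult_1_l in Hc Hs; apply: Rmax_lub.
Qed.

Definition node (rho : R) (m k : nat) : C :=
  (RtoC rho * cis (INR k * (2 * PI / INR m.+1)))%C.

Lemma Cmod_node rho m k : 0 <= rho -> Cmod (node rho m k) = rho.
Proof. by move=> H; rewrite Cmod_mult Cmod_cis Cmod_R Rabs_pos_eq; lra. Qed.

Lemma sum_n_geometric (w : C) m :
  (sum_n (fun k => w ^ k) m * (w - 1) = w ^ m.+1 - 1)%C.
Proof.
elim: m => [|m IH]; first by rewrite sum_O /=; ring.
rewrite sum_Sn -[plus _ _]/(Cplus _ _) Cmult_plus_distr_r IH /=; ring.
Qed.

Lemma sum_n_const_C (a : C) m :
  sum_n (fun=> a) m = (RtoC (INR m.+1) * a)%C :> C.
Proof.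
elim: m => [|m IH]; first by rewrite sum_O Cmult_1_l.
by rewrite sum_Sn IH (S_INR m.+1) RtoC_plus -[plus _ _]/(Cplus _ _); ring.
Qed.

Lemma node_pow_sum rho m j : (0 < j <= m)%nat ->
  sum_n (fun k => (node rho m k ^ j)%C) m = RtoC 0 :> C.
Proof.
case/andP=> /ltP j0 /leP jm.
have m0 : 0 < INR m.+1 by apply: lt_0_INR; lia.
set w := cis (INR j * (2 * PI / INR m.+1)).
have E k : (node rho m k ^ j = RtoC rho ^ j * w ^ k)%C.
  rewrite Cpow_mult_l cis_pow /w cis_pow; congr (_ * cis _)%C; ring.
rewrite (sum_n_ext _ _ _ E) (sum_n_mult_l (K := C_Ring) (RtoC rho ^ j)%C).
have w1 : (w - 1)%C <> RtoC 0.
  move=> H; apply: (cis_neq1 (INR j * (2 * PI / INR m.+1))).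
    have P0 := PI_RGT_0.
    have j1 : 0 < INR j by apply: lt_0_INR; lia.
    have jm1 : INR j < INR m.+1 by apply: lt_INR; lia.
    split; first by apply: Rmult_lt_0_compat => //; apply: Rdiv_lt_0_compat; lra.
    apply: (Rmult_lt_reg_r (INR m.+1)) => //.
    have -> : INR j * (2 * PI / INR m.+1) * INR m.+1 = 2 * PI * INR j
      by field; lra.
    by apply: Rmult_lt_compat_l; lra.
  by have -> : cis (INR j * (2 * PI / INR m.+1)) = (w - 1 + 1)%C
    by [rewrite /w; ring]; rewrite H; ring.
have wm : (w ^ m.+1 = 1)%C.
  rewrite /w cis_pow.
  have -> : INR m.+1 * (INR j * (2 * PI / INR m.+1)) = INR j * (2 * PI).
    by field; lra.
  rewrite -cis_pow cis_2PI; exact: Cpow_1_l.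
have := sum_n_geometric w m; rewrite wm => H.
have S0 : sum_n (fun k => (w ^ k)%C) m = RtoC 0 :> C.
  set S := sum_n _ m in H *.
  have -> : (S : C) = (S * (w - 1) / (w - 1))%C.
    by rewrite /Cdiv -Cmult_assoc Cinv_r // Cmult_1_r.
  by rewrite H; field.
rewrite S0; exact: Cmult_0_r.
Qed.

Lemma node_pow_full rho m k : (node rho m k ^ m.+1 = RtoC (rho ^ m.+1))%C.
Proof.
have m0 : INR m.+1 <> 0 by apply: not_0_INR.
rewrite Cpow_mult_l cis_pow RtoC_pow.
have -> : INR m.+1 * (INR k * (2 * PI / INR m.+1)) = INR k * (2 * PI).
  by field.
by rewrite -cis_pow cis_2PI Cpow_1_l Cmult_1_r.
Qed.

(** * Sequences converging with rate 1 / m *)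

Lemma le_of_inv_small x y L (m0 : nat) :
  (forall m, (m0 <= m)%nat -> x <= y + L * / INR m.+1) -> x <= y.
Proof.
move=> H; apply: Rnot_lt_le => yx.
have e0 : 0 < (x - y) / (Rabs L + 1).
  by apply: Rdiv_lt_0_compat; [lra | have := Rabs_pos L; lra].
have [n [Hn n0]] := archimed_cor1 _ e0.
pose m := maxn m0 n.
have := H m (leq_maxl _ _).
have m1 : 0 < / INR m.+1 by apply: Rinv_0_lt_compat; apply: lt_0_INR; lia.
have m2 : / INR m.+1 < (x - y) / (Rabs L + 1).
  apply: Rle_lt_trans Hn; apply: Rinv_le_contravar; first exact: lt_0_INR.
  by apply: le_INR; have /leP := leq_maxr m0 n; rewrite -/m; lia.
have : L * / INR m.+1 <= (Rabs L + 1) * / INR m.+1.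
  by apply: Rmult_le_compat_r; [lra | have := Rle_abs L; lra].
have : (Rabs L + 1) * / INR m.+1 < (Rabs L + 1) * ((x - y) / (Rabs L + 1)).
  by apply: Rmult_lt_compat_l => //; have := Rabs_pos L; lra.
have -> : (Rabs L + 1) * ((x - y) / (Rabs L + 1)) = x - y.
  by field; have := Rabs_pos L; lra.
lra.
Qed.

Section RieszProjections.

Variable B : CompleteNormedModule C_AbsRing.
Let NB := norm_is_norm B.

(** An explicit rate makes limits of sums and of compositions elementary. *)
Definition cv_inv (x : B) (s : nat -> B) : Prop :=
  exists L, forall m, norm (minus x (s m)) <= L * / INR m.+1.

(** Continuity of a weaker norm suffices to pass to the limit in a bound. *)
Lemma cv_inv_le (N : B -> R) C y x s m0 : is_norm N ->
  (forall u, N u <= C * norm u) -> 0 <= C -> cv_inv x s ->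
  (forall m, (m0 <= m)%nat -> N (s m) <= y) -> N x <= y.
Proof.
move=> NN NC C0 [L HL] H; apply: (le_of_inv_small _ _ (C * L) m0) => m Hm.
have := is_norm_split NN x (s m); have := H m Hm.
have := NC (minus x (s m)); have := Rmult_le_compat_l _ _ _ C0 (HL m).
lra.
Qed.

Lemma cv_inv_unique x y s : cv_inv x s -> cv_inv y s -> x = y.
Proof.
move=> [L HL] [L' HL'].
have E : minus x y = zero.
  apply: norm_small_zero => e e0.
  apply: Rle_trans (Rlt_le _ _ e0).
  apply: (le_of_inv_small _ _ (L + L') 0) => m _.
  have -> : minus x y = minus (minus x (s m)) (minus y (s m)) by module_ring B.
  apply: Rle_trans (is_norm_minus NB _ _) _.
  have := HL m; have := HL' m; lra.
have -> : x = plus (minus x y) y by module_ring B.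
by rewrite E plus_zero_l.
Qed.

Lemma cv_inv_ext x s s' : (forall m, s m = s' m) -> cv_inv x s -> cv_inv x s'.
Proof. by move=> E [L HL]; exists L => m; rewrite -E. Qed.

Lemma cv_inv_plus x y s s' : cv_inv x s -> cv_inv y s' ->
  cv_inv (plus x y) (fun m => plus (s m) (s' m)).
Proof.
move=> [L HL] [L' HL']; exists (L + L') => m.
have -> : minus (plus x y) (plus (s m) (s' m))
  = plus (minus x (s m)) (minus y (s' m)) by module_ring B.
apply: Rle_trans (is_norm_triangle NB _ _) _.
have := HL m; have := HL' m; lra.
Qed.

Lemma cv_inv_linear (T : B -> B) x s : is_linear T -> cv_inv x s ->
  cv_inv (T x) (fun m => T (s m)).
Proof.
move=> TL [L HL]; have [K [K0 HK]] := linear_norm _ TL.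
exists (K * L) => m; rewrite -(linear_minus _ _ _ TL).
apply: Rle_trans (HK _) _; rewrite Rmult_assoc.
by apply: Rmult_le_compat_l; [lra | apply: HL].
Qed.

Lemma scal_is_linear (a : C) : is_linear (fun x : B => scal a x).
Proof. by apply: is_linear_scal_r => u v; apply: Cmult_comm. Qed.

Lemma cv_inv_minus x y s s' : cv_inv x s -> cv_inv y s' ->
  cv_inv (minus x y) (fun m => minus (s m) (s' m)).
Proof.
move=> H H'.
have Hy := cv_inv_linear _ _ _ (scal_is_linear (RtoC (-1))) H'.
have := cv_inv_plus _ _ _ _ H Hy.
have -> : plus x (scal (RtoC (-1)) y) = minus x y by module_ring B.
by apply: cv_inv_ext => m; module_ring B.
Qed.

(** * Riemann sums of Lipschitz functions *)

Lemma lipschitz_ex_RInt (f : R -> B) L a b : 0 <= L ->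
  (forall s t, norm (minus (f t) (f s)) <= L * Rabs (t - s)) ->
  ex_RInt (V := realify B) f a b.
Proof.
move=> L0 Hf; apply: ex_RInt_continuous => t _.
apply/filterlim_locally => e.
have d0 : 0 < e / (L + 1) by apply: Rdiv_lt_0_compat; [exact: cond_pos | lra].
exists (mkposreal _ d0) => s Hs.
apply: (norm_compat1 (V := realify B)).
apply: Rle_lt_trans (Hf t s) _.
have {}Hs : Rabs (s - t) < e / (L + 1) by exact: Hs.
have := Rmult_le_compat_l _ _ _ L0 (Rlt_le _ _ Hs).
have : L * (e / (L + 1)) < e.
  apply: (Rmult_lt_reg_r (L + 1)); first lra.
  have -> : L * (e / (L + 1)) * (L + 1) = L * e by field; lra.
  have := cond_pos e; nra.
lra.
Qed.

Lemma RInt_one_step (f : R -> B) L a b : 0 <= L -> a <= b ->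
  (forall s t, norm (minus (f t) (f s)) <= L * Rabs (t - s)) ->
  norm (minus (RInt (V := realify B) f a b) (scal (RtoC (b - a)) (f a)))
    <= L * (b - a) ^ 2.
Proof.
move=> L0 ab Hf.
have I : is_RInt (V := realify B) (fun t => minus (f t) (f a)) a b
    (minus (RInt (V := realify B) f a b) (scal (RtoC (b - a)) (f a))).
  apply: (is_RInt_minus (V := realify B)).
    by apply: RInt_correct; apply: lipschitz_ex_RInt Hf.
  exact: (is_RInt_const (V := realify B) a b (f a)).
have -> : L * (b - a) ^ 2 = (b - a) * (L * (b - a)) by ring.
apply: (norm_RInt_le_const (V := realify B) _ _ _ _ _ ab _ I) => t Ht.
apply: Rle_trans (Hf a t) _; apply: Rmult_le_compat_l => //.
by rewrite Rabs_pos_eq; lra.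
Qed.

Lemma RInt_uniform_sum (f : R -> B) L h n : 0 <= L -> 0 <= h ->
  (forall s t, norm (minus (f t) (f s)) <= L * Rabs (t - s)) ->
  norm (minus (RInt (V := realify B) f 0 (INR n.+1 * h))
     (scal (RtoC h) (sum_n (fun k => f (INR k * h)) n)))
    <= INR n.+1 * (L * h ^ 2).
Proof.
move=> L0 h0 Hf; elim: n => [|n IH].
  rewrite sum_O /= !Rmult_1_l Rmult_0_l.
  have := RInt_one_step f L 0 h L0 h0 Hf.
  by rewrite Rminus_0_r /= !Rmult_1_r.
have ex a b : ex_RInt (V := realify B) f a b by apply: lipschitz_ex_RInt Hf.
have step : INR n.+1 * h <= INR n.+2 * h by rewrite (S_INR n.+1); lra.
have := RInt_one_step f L _ _ L0 step Hf.
have -> : INR n.+2 * h - INR n.+1 * h = h by rewrite (S_INR n.+1); ring.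
rewrite -(RInt_Chasles (V := realify B) f 0 (INR n.+1 * h) (INR n.+2 * h)) //.
rewrite sum_Sn => H.
set I1 := RInt (V := realify B) f 0 _ in IH *.
set I2 := RInt (V := realify B) f _ _ in H *.
set S := sum_n _ n in IH *; set y := f (INR n.+1 * h) in H *.
have -> : minus (plus (I1 : B) (I2 : B)) (scal (RtoC h) (plus S y))
  = plus (minus (I1 : B) (scal (RtoC h) S)) (minus (I2 : B) (scal (RtoC h) y))
  by module_ring B.
apply: Rle_trans (is_norm_triangle NB _ _) _.
rewrite (S_INR n.+1) Rmult_plus_distr_r Rmult_1_l.
exact: Rplus_le_compat.
Qed.

(** * Riesz projections *)

Variables (P : B -> B) (P_linear : is_linear P) (c : C) (k : R).
Hypothesis k_pos : 0 < k.

Definition shifted : B -> B := fun x => minus (P x) (scal c x).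

Lemma shifted_linear : is_linear shifted.
Proof.
have E x : shifted x = scal (RtoC (-1)) (z_minus c P x)
  by rewrite /shifted; module_ring B.
have L := is_linear_comp _ _ (z_minus_linear _ P c P_linear)
  (scal_is_linear (RtoC (-1))).
exact: is_linear_ext _ _ (fun x => esym (E x)) L.
Qed.

(** The average of [zeta ^ (j + 1) * (c + zeta - P)^-1] over the nodes: for
    [j = 0] this is the Riemann sum of the Riesz projection. *)
Definition moment rho m j (phi : B) : B :=
  scal (/ RtoC (INR m.+1))%C (sum_n (fun i =>
    scal (node rho m i ^ j.+1)%C (resolvent P (c + node rho m i)%C phi)) m).

Definition circle_regular rho : Prop :=
  forall z, Cmod (z - c)%C = rho -> regular P k z.

Lemma circle_regular_node rho m i : 0 < rho -> circle_regular rho ->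
  regular P k (c + node rho m i)%C.
Proof.
move=> r0; apply.
have -> : (c + node rho m i - c = node rho m i)%C by ring.
by apply: Cmod_node; lra.
Qed.

Lemma sum_n_scal_vector (a : nat -> C) (x : B) n :
  sum_n (fun i => scal (a i) x) n = scal (sum_n a n) x.
Proof.
elim: n => [|n IH]; first by rewrite !sum_O.
by rewrite !sum_Sn IH -(scal_distr_r (sum_n a n) (a n.+1) x).
Qed.

Lemma RtoC_INR_neq0 m : RtoC (INR m.+1) <> RtoC 0.
Proof. by move=> [H]; apply: (not_0_INR m.+1) => //. Qed.

(** From [(P - c) (c + zeta - P)^-1 = zeta (c + zeta - P)^-1 - 1]. *)
Lemma shifted_moment rho m j phi : 0 < rho -> circle_regular rho ->
  shifted (moment rho m j phi)
  = minus (moment rho m j.+1 phi)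
      (scal (/ RtoC (INR m.+1)
             * sum_n (fun i => (node rho m i ^ j.+1)%C) m)%C phi).
Proof.
move=> r0 H; have TL := shifted_linear.
rewrite /moment (linear_scal _ TL) (linear_sum _ shifted) //.
have -> : sum_n (fun i => shifted (scal (node rho m i ^ j.+1)%C
      (resolvent P (c + node rho m i)%C phi))) m
  = sum_n (fun i => plus (scal (node rho m i ^ j.+2)%C
      (resolvent P (c + node rho m i)%C phi))
      (scal (RtoC (-1)) (scal (node rho m i ^ j.+1)%C phi))) m.
  apply: sum_n_ext => i; rewrite (linear_scal _ TL).
  have [S _] := circle_regular_node rho m i r0 H.
  set z := node rho m i; set u := resolvent _ _ _.
  have E : phi = z_minus (c + z)%C P u by rewrite not_spectrum_right.
  have -> : shifted u = minus (scal z u) phi.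
    by rewrite {1}E /shifted; module_ring B.
  by rewrite -[(z ^ j.+2)%C]/(z * z ^ j.+1)%C; module_ring B.
rewrite sum_n_plus sum_n_scal_l sum_n_scal_vector.
by module_ring B.
Qed.

Lemma iter_shifted_moment rho m j phi : 0 < rho -> circle_regular rho ->
  (j <= m)%nat -> Nat.iter j shifted (moment rho m 0 phi) = moment rho m j phi.
Proof.
move=> r0 H; elim: j => [//|j IH] jm /=.
rewrite IH; last exact: ltnW.
rewrite shifted_moment // node_pow_sum //.
by module_ring B.
Qed.

(** With [n = m + 1] and [T = P - c], the Riemann sum [e] satisfies
    [(rho^n - T^n) e phi = rho^n phi]: partial fractions at the [n]-th roots. *)
Lemma iter_shifted_full rho m phi : 0 < rho -> circle_regular rho ->
  Nat.iter m.+1 shifted (moment rho m 0 phi)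
  = scal (RtoC (rho ^ m.+1)) (minus (moment rho m 0 phi) phi).
Proof.
move=> r0 H.
rewrite -[LHS]/(shifted (Nat.iter m shifted (moment rho m 0 phi))).
rewrite iter_shifted_moment // shifted_moment //.
have m0 := RtoC_INR_neq0 m.
have -> : sum_n (fun i => (node rho m i ^ m.+1)%C) m
    = (RtoC (INR m.+1) * RtoC (rho ^ m.+1))%C.
  rewrite (sum_n_ext _ (fun=> RtoC (rho ^ m.+1))); last first.
    by move=> i; rewrite node_pow_full.
  exact: sum_n_const_C.
have -> : moment rho m m.+1 phi = scal (RtoC (rho ^ m.+1)) (moment rho m 0 phi).
  rewrite {2}/moment; set s := (/ RtoC _)%C.
  rewrite (_ : scal (RtoC (rho ^ m.+1)) (scal s _)
     = scal s (scal (RtoC (rho ^ m.+1)) (sum_n (fun i =>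
    scal (node rho m i ^ 1)%C (resolvent P (c + node rho m i)%C phi)) m)));
    last by module_ring B.
  rewrite /moment -/s; congr scal.
  rewrite -(sum_n_scal_l (RtoC (rho ^ m.+1))); apply: sum_n_ext => i.
  rewrite -(node_pow_full rho m i).
  set z := node rho m i.
  by rewrite -[(z ^ m.+2)%C]/(z * z ^ m.+1)%C -[(z ^ 1)%C]/(z * 1)%C;
    module_ring B.
by compare_coefficients B; field.
Qed.

Lemma moment_is_linear rho m j : 0 < rho -> circle_regular rho ->
  (forall x y, moment rho m j (plus x y)
     = plus (moment rho m j x) (moment rho m j y)) /\
  (forall (a : C) x, moment rho m j (scal a x) = scal a (moment rho m j x)) /\
  (forall x, moment rho m j (P x) = P (moment rho m j x)).
Proof.
move=> r0 H.
have RL i := resolvent_linear _ P _ (proj1 (circle_regular_node rho m i r0 H)).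
split; [move=> x y | split => [a x | x]]; rewrite /moment.
- rewrite -(scal_distr_l (/ RtoC (INR m.+1))%C) -sum_n_plus; congr scal.
  apply: sum_n_ext => i; rewrite (linear_plus _ (RL i)); exact: scal_distr_l.
- rewrite (_ : scal a (scal _ ?[s]) = scal (/ RtoC (INR m.+1))%C (scal a ?s));
    last by module_ring B.
  rewrite -(sum_n_scal_l a); congr scal.
  by apply: sum_n_ext => i; rewrite (linear_scal _ (RL i)); module_ring B.
rewrite (linear_scal _ P_linear) (linear_sum _ P) //; congr scal.
apply: sum_n_ext => i; rewrite (linear_scal _ P_linear) resolvent_comm //.
exact: (proj1 (circle_regular_node rho m i r0 H)).
Qed.

Lemma moment_iter_shifted rho m n phi : 0 < rho -> circle_regular rho ->
  moment rho m 0 (Nat.iter n shifted phi)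
  = Nat.iter n shifted (moment rho m 0 phi).
Proof.
move=> r0 H; have [Hp [Hs HP]] := moment_is_linear rho m 0 r0 H.
have E x : shifted x = plus (P x) (scal (- c)%C x)
  by rewrite /shifted; module_ring B.
elim: n => [//|n IH] /=.
by rewrite E Hp Hs HP IH -E.
Qed.

(** The Riemann sums [e1], [e2] at two radii satisfy an analogue of the resolvent
    identity, obtained by comparing [e1 (T^n (e2 phi))] with
    [T^n (e1 (e2 phi))]. *)
Lemma moment_two_radii rho1 rho2 m phi :
  0 < rho1 -> 0 < rho2 -> circle_regular rho1 -> circle_regular rho2 ->
  scal (RtoC (rho2 ^ m.+1) - RtoC (rho1 ^ m.+1))%C
    (moment rho1 m 0 (moment rho2 m 0 phi))
  = minus (scal (RtoC (rho2 ^ m.+1)) (moment rho1 m 0 phi))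
      (scal (RtoC (rho1 ^ m.+1)) (moment rho2 m 0 phi)).
Proof.
move=> r1 r2 H1 H2; have [Hp [Hs HP]] := moment_is_linear rho1 m 0 r1 H1.
set q1 := RtoC (rho1 ^ m.+1); set q2 := RtoC (rho2 ^ m.+1).
set u := moment rho2 m 0 phi.
have := moment_iter_shifted rho1 m m.+1 u r1 H1.
rewrite iter_shifted_full // {1}/u iter_shifted_full // -/u -/q1 -/q2.
have -> : scal q2 (minus u phi) = plus (scal q2 u) (scal (- q2)%C phi)
  by module_ring B.
rewrite Hp (Hs q2 u) (Hs (- q2)%C phi) => E.
set v := moment rho1 m 0 u in E *; set w := moment rho1 m 0 phi in E *.
have -> : scal (q2 - q1)%C v
    = minus (plus (plus (scal q2 v) (scal (- q2)%C w)) (scal q2 w)) (scal q1 v)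
  by module_ring B.
by rewrite E; module_ring B.
Qed.

Lemma moment_bound (N : B -> R) rho m j phi y : is_norm N -> 0 < rho ->
  (forall z, Cmod (z - c)%C = rho -> N (resolvent P z phi) <= y) ->
  N (moment rho m j phi) <= rho ^ j.+1 * y.
Proof.
move=> NN r0 H; rewrite /moment (is_norm_scal NN).
have m0 : 0 < INR m.+1 by apply: lt_0_INR; lia.
rewrite Cmod_inv; last exact: RtoC_INR_neq0.
rewrite Cmod_R Rabs_pos_eq; last lra.
apply: (Rmult_le_reg_l (INR m.+1)) => //.
rewrite -Rmult_assoc Rinv_r ?Rmult_1_l; last lra.
apply: is_norm_sum => // i _.
rewrite (is_norm_scal NN) Cmod_pow Cmod_node; last lra.
apply: Rmult_le_compat_l; first by apply: pow_le; lra.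
apply: H.
have -> : (c + node rho m i - c = node rho m i)%C by ring.
by apply: Cmod_node; lra.
Qed.

(** The integrand is Lipschitz since the resolvent is, by the resolvent identity. *)
Lemma circle_sum_cv rho : 0 < rho -> circle_regular rho ->
  exists L, 0 <= L /\ forall phi m,
  norm (minus (circle_proj P c rho phi) (moment rho m 0 phi))
    <= L * norm phi * / INR m.+1.
Proof.
move=> r0 H.
pose Lf (phi : B) := 2 * (rho / k) * (1 + rho / k) * norm phi.
have K0 : 0 < rho / k by apply: Rdiv_lt_0_compat.
have P0 := PI_RGT_0.
exists (2 * PI * (2 * (rho / k) * (1 + rho / k))).
split; first by apply: Rmult_le_pos; [|apply: Rmult_le_pos]; lra.
move=> phi m.
pose f t := scal (Ci * RtoC rho * (cos t, sin t))%C
  (resolvent P (circle_pt c rho t) phi).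
have reg t : regular P k (circle_pt c rho t).
  apply: H; rewrite /circle_pt.
  have -> : (c + RtoC rho * (cos t, sin t) - c = RtoC rho * cis t)%C.
    by rewrite /cis; ring.
  by rewrite Cmod_mult Cmod_cis Cmod_R Rabs_pos_eq; lra.
have n0 := norm_ge_0 phi.
have L0 : 0 <= Lf phi.
  by apply: Rmult_le_pos => //; apply: Rmult_le_pos; lra.
have Hf s t : norm (minus (f t) (f s)) <= Lf phi * Rabs (t - s).
  set u := resolvent P (circle_pt c rho t) phi.
  set v := resolvent P (circle_pt c rho s) phi.
  have -> : minus (f t) (f s)
      = plus (scal (Ci * RtoC rho * (cis t - cis s))%C u)
             (scal (Ci * RtoC rho * cis s)%C (minus u v)).
    by rewrite /f -/u -/v -/(cis t) -/(cis s); module_ring B.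
  apply: Rle_trans (is_norm_triangle NB _ _) _.
  rewrite !(is_norm_scal NB) !Cmod_mult Cmod_Ci Cmod_cis Cmod_R.
  rewrite Rabs_pos_eq; last lra.
  have X1 : norm u <= / k * norm phi by apply: resolvent_bound.
  have X2 := resolvent_lipschitz _ P k _ _ phi k_pos (reg t) (reg s).
  rewrite -/u -/v in X2.
  have E : (circle_pt c rho t - circle_pt c rho s
      = RtoC rho * (cis t - cis s))%C by rewrite /circle_pt /cis; ring.
  rewrite E Cmod_mult Cmod_R Rabs_pos_eq in X2; last lra.
  have X3 := cis_lipschitz s t.
  have ik : 0 < / k by apply: Rinv_0_lt_compat.
  have X4 : Cmod (cis t - cis s)%C * norm u
      <= 2 * Rabs (t - s) * (/ k * norm phi).
    by apply: Rmult_le_compat => //; [exact: Cmod_ge_0 | exact: norm_ge_0].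
  have X5 : rho * Cmod (cis t - cis s)%C * (/ k * (/ k * norm phi))
      <= rho * (2 * Rabs (t - s)) * (/ k * (/ k * norm phi)).
    apply: Rmult_le_compat_r.
      by do 2![apply: Rmult_le_pos; first lra].
    by apply: Rmult_le_compat_l; lra.
  have X6 := Rmult_le_compat_l rho _ _ (Rlt_le _ _ r0) X4.
  have X7 := Rmult_le_compat_l rho _ _ (Rlt_le _ _ r0) (Rle_trans _ _ _ X2 X5).
  rewrite /Lf /Rdiv; lra.
have m0 : 0 < INR m.+1 by apply: lt_0_INR; lia.
set h := 2 * PI / INR m.+1.
have h0 : 0 <= h by apply: Rdiv_le_0_compat; lra.
have := RInt_uniform_sum f (Lf phi) h m L0 h0 Hf.
have -> : INR m.+1 * h = 2 * PI by rewrite /h; field; lra.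
rewrite /circle_proj /circle_integral -/f.
set J := RInt (V := realify B) f 0 (2 * PI).
have ci : Ci <> RtoC 0 by move=> /(f_equal snd) /=; lra.
have pi2 : RtoC (2 * PI) <> RtoC 0 by move=> /RtoC_inj; lra.
have -> : scal (RtoC h) (sum_n (fun i => f (INR i * h)) m)
    = scal (RtoC (2 * PI) * Ci)%C (moment rho m 0 phi).
  rewrite /moment.
  have -> : sum_n (fun i => f (INR i * h)) m = scal Ci (sum_n (fun i =>
     scal (node rho m i ^ 1)%C (resolvent P (c + node rho m i)%C phi)) m).
    rewrite -(sum_n_scal_l Ci); apply: sum_n_ext => i.
    rewrite /f -[circle_pt _ _ _]/(c + node rho m i)%C.
    set z := node rho m i.
    have -> : (Ci * RtoC rho * (cos (INR i * h), sin (INR i * h)) = Ci * z)%C.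
      by rewrite /z /node /cis -/h; ring.
    by rewrite -[(z ^ 1)%C]/(z * 1)%C; module_ring B.
  rewrite /h /Rdiv RtoC_mult RtoC_inv; last lra.
  by module_ring B.
move=> HJ.
have -> : minus (scal (/ (RtoC (2 * PI) * Ci))%C (J : B)) (moment rho m 0 phi)
  = scal (/ (RtoC (2 * PI) * Ci))%C
      (minus (J : B) (scal (RtoC (2 * PI) * Ci)%C (moment rho m 0 phi))).
  by compare_coefficients B; field.
rewrite (is_norm_scal NB) Cmod_inv; last exact: Cmult_neq_0.
rewrite Cmod_mult Cmod_Ci Cmod_R Rabs_pos_eq; last lra.
apply: (Rmult_le_reg_l (2 * PI)); first lra.
rewrite -Rmult_assoc Rmult_1_r Rinv_r ?Rmult_1_l; last lra.
apply: Rle_trans HJ _; rewrite /h /Lf; apply: Req_le.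
by field; lra.
Qed.

Lemma moment_norm rho m j phi : 0 < rho -> circle_regular rho ->
  norm (moment rho m j phi) <= rho ^ j.+1 * (/ k * norm phi).
Proof.
move=> r0 H; apply: moment_bound => // z Hz.
by apply: resolvent_bound => //; apply: H.
Qed.

Lemma circle_proj_cv rho phi : 0 < rho -> circle_regular rho ->
  cv_inv (circle_proj P c rho phi) (fun m => moment rho m 0 phi).
Proof.
move=> r0 H; have [L [_ HL]] := circle_sum_cv rho r0 H.
by exists (L * norm phi) => m; apply: HL.
Qed.

Lemma circle_proj_le (N : B -> R) C rho phi y : is_norm N ->
  (forall u, N u <= C * norm u) -> 0 <= C -> 0 < rho -> circle_regular rho ->
  (forall z, Cmod (z - c)%C = rho -> N (resolvent P z phi) <= y) ->
  N (circle_proj P c rho phi) <= rho * y.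
Proof.
move=> NN NC C0 r0 H Hy.
apply: (cv_inv_le N C _ _ _ 0 NN NC C0 (circle_proj_cv rho phi r0 H)) => m _.
by have := moment_bound N rho m 0 phi y NN r0 Hy; rewrite pow_1.
Qed.

Lemma norm_le1 (u : B) : norm u <= 1 * norm u.
Proof. by rewrite Rmult_1_l; apply: Rle_refl. Qed.

Lemma circle_proj_norm rho phi : 0 < rho -> circle_regular rho ->
  norm (circle_proj P c rho phi) <= rho / k * norm phi.
Proof.
move=> r0 H; rewrite /Rdiv Rmult_assoc.
apply: (circle_proj_le norm 1) => //; try lra; first exact: norm_le1.
by move=> z Hz; apply: resolvent_bound => //; apply: H.
Qed.

Lemma circle_proj_linear rho : 0 < rho -> circle_regular rho ->
  is_linear (circle_proj P c rho).
Proof.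
move=> r0 H.
split=> [x y|a x|].
- apply: cv_inv_unique (circle_proj_cv rho _ r0 H) _.
  have := cv_inv_plus _ _ _ _ (circle_proj_cv rho x r0 H)
    (circle_proj_cv rho y r0 H).
  apply: cv_inv_ext => m.
  by have [-> _] := moment_is_linear rho m 0 r0 H.
- apply: cv_inv_unique (circle_proj_cv rho _ r0 H) _.
  have := cv_inv_linear _ _ _ (scal_is_linear a) (circle_proj_cv rho x r0 H).
  apply: cv_inv_ext => m.
  by have [_ [-> _]] := moment_is_linear rho m 0 r0 H.
exists (rho / k); split; first exact: Rdiv_lt_0_compat.
by move=> x; apply: circle_proj_norm.
Qed.

Lemma moment_comp_cv rho1 rho2 phi : 0 < rho1 -> 0 < rho2 ->
  circle_regular rho1 -> circle_regular rho2 ->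
  cv_inv (circle_proj P c rho1 (circle_proj P c rho2 phi))
    (fun m => moment rho1 m 0 (moment rho2 m 0 phi)).
Proof.
move=> r1 r2 H1 H2.
have EL := circle_proj_linear rho1 r1 H1.
have [L1 [L10 HL1]] := circle_sum_cv rho1 r1 H1.
have [L2 HL2] := circle_proj_cv rho2 phi r2 H2.
exists (rho1 / k * L2 + L1 * (rho2 / k * norm phi)) => m.
set u := circle_proj P c rho2 phi in HL2 *; set v := moment rho2 m 0 phi.
have -> : minus (circle_proj P c rho1 u) (moment rho1 m 0 v)
  = plus (circle_proj P c rho1 (minus u v))
      (minus (circle_proj P c rho1 v) (moment rho1 m 0 v)).
  by rewrite (linear_minus _ _ _ EL); module_ring B.
apply: Rle_trans (is_norm_triangle NB _ _) _.
have K0 : 0 <= rho1 / k by apply: Rlt_le; apply: Rdiv_lt_0_compat.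
have X1 := circle_proj_norm rho1 (minus u v) r1 H1.
have X2 := Rmult_le_compat_l _ _ _ K0 (HL2 m).
have X3 := HL1 v m.
have X4 : L1 * norm v * / INR m.+1 <= L1 * (rho2 / k * norm phi) * / INR m.+1.
  apply: Rmult_le_compat_r.
    by apply: Rlt_le; apply: Rinv_0_lt_compat; apply: lt_0_INR; lia.
  apply: Rmult_le_compat_l => //.
  by have := moment_norm rho2 m 0 phi r2 H2; rewrite pow_1 /Rdiv Rmult_assoc.
rewrite -/v in X2; lra.
Qed.

(** Letting the number of nodes tend to infinity in the identity between two
    radii, the smaller circle wins: [(rho1 / rho2) ^ m] tends to zero. *)
Lemma circle_proj_comp rho1 rho2 phi : 0 < rho1 -> rho1 < rho2 ->
  circle_regular rho1 -> circle_regular rho2 ->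
  circle_proj P c rho1 (circle_proj P c rho2 phi) = circle_proj P c rho1 phi /\
  circle_proj P c rho2 (circle_proj P c rho1 phi) = circle_proj P c rho1 phi.
Proof.
move=> r1 r12 H1 H2; have r2 : 0 < rho2 by lra.
have powlt m : rho1 ^ m.+1 < rho2 ^ m.+1.
  elim: m => [|m IH]; first by rewrite !pow_1.
  rewrite -[rho1 ^ m.+2]/(rho1 * rho1 ^ m.+1) -[rho2 ^ m.+2]/(rho2 * rho2 ^ m.+1).
  have := pow_lt rho1 m.+1 r1; nra.
have E m : moment rho1 m 0 (moment rho2 m 0 phi)
    = moment rho2 m 0 (moment rho1 m 0 phi).
  have X12 := moment_two_radii rho1 rho2 m phi r1 r2 H1 H2.
  have X21 := moment_two_radii rho2 rho1 m phi r2 r1 H2 H1.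
  set a := RtoC (rho1 ^ m.+1) in X12 X21; set b := RtoC (rho2 ^ m.+1) in X12 X21.
  have ab : (b - a)%C <> RtoC 0.
    by rewrite /a /b -RtoC_minus => /RtoC_inj; have := powlt m; lra.
  set u := moment rho1 m 0 _ in X12 *; set v := moment rho2 m 0 _ in X21 *.
  have -> : u = scal (/ (b - a))%C (scal (b - a)%C u).
    by compare_coefficients B; field.
  rewrite X12.
  have -> : v = scal (- / (b - a))%C (scal (a - b)%C v).
    by compare_coefficients B; field.
  by rewrite X21; module_ring B.
suff cv : cv_inv (circle_proj P c rho1 phi)
    (fun m => moment rho1 m 0 (moment rho2 m 0 phi)).
  split; apply: cv_inv_unique (moment_comp_cv _ _ phi _ _ _ _) _ => //.
  exact: cv_inv_ext cv.
have [L HL] := circle_proj_cv rho1 phi r1 H1.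
set h := rho2 / rho1 - 1.
have h0 : 0 < h.
  apply: (Rmult_lt_reg_r rho1) => //.
  by rewrite /h Rmult_minus_distr_r /Rdiv Rmult_assoc Rinv_l; lra.
set D := rho1 / k * (rho2 / k * norm phi) + rho2 / k * norm phi.
exists (L + / h * D) => m.
set w := moment rho1 m 0 phi; set v := moment rho2 m 0 phi.
set u := moment rho1 m 0 v.
set p := (rho1 / rho2) ^ m.+1.
have m0 : 0 < INR m.+1 by apply: lt_0_INR; lia.
have X := moment_two_radii rho1 rho2 m phi r1 r2 H1 H2.
rewrite -/w -/v -/u in X.
have r2n : rho2 ^ m.+1 <> 0 by apply: pow_nonzero; lra.
have pE : rho1 ^ m.+1 = p * rho2 ^ m.+1.
  by rewrite /p -Rpow_mult_distr; congr (_ ^ _); field; lra.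
have uE : minus w u = scal (RtoC p) (minus v u).
  have cn : RtoC (rho2 ^ m.+1) <> RtoC 0 by move=> /RtoC_inj.
  rewrite pE RtoC_mult in X; set b := RtoC (rho2 ^ m.+1) in X cn.
  set p' := RtoC p in X *.
  have -> : minus w u = scal (/ b)%C (plus (minus (scal b w) (scal (p' * b)%C v))
      (minus (scal (p' * b)%C v) (scal b u))).
    by compare_coefficients B; field.
  by rewrite -X; compare_coefficients B; field.
have -> : minus (circle_proj P c rho1 phi) u
    = plus (minus (circle_proj P c rho1 phi) w) (scal (RtoC p) (minus v u)).
  by rewrite -uE; module_ring B.
apply: Rle_trans (is_norm_triangle NB _ _) _.
rewrite (is_norm_scal NB) Cmod_R Rabs_pos_eq; last first.
  by apply: pow_le; apply: Rlt_le; apply: Rdiv_lt_0_compat; lra.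
(* Bernoulli's inequality bounds the geometric decay by that of [/ m]. *)
have pb : p <= / h * / INR m.+1.
  have := poly m.+1 h h0.
  have -> : 1 + h = rho2 / rho1 by rewrite /h; ring.
  have hm : 0 < INR m.+1 * h by apply: Rmult_lt_0_compat.
  have -> : p = / (rho2 / rho1) ^ m.+1.
    by rewrite -pow_inv /p; congr (_ ^ _); field; lra.
  move=> bern; rewrite -Rinv_mult Rmult_comm.
  apply: Rinv_le_contravar => //; lra.
have n0 := norm_ge_0 phi.
have vb : norm v <= rho2 / k * norm phi.
  by have := moment_norm rho2 m 0 phi r2 H2; rewrite pow_1 /Rdiv Rmult_assoc.
have ub : norm u <= rho1 / k * (rho2 / k * norm phi).
  have := moment_norm rho1 m 0 v r1 H1; rewrite pow_1 -Rmult_assoc => ub.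
  apply: Rle_trans ub _; apply: Rmult_le_compat_l => //.
  by apply: Rlt_le; apply: Rdiv_lt_0_compat.
have db : norm (minus v u) <= D.
  by apply: Rle_trans (is_norm_minus NB _ _) _; rewrite /D; lra.
have : p * norm (minus v u) <= / h * / INR m.+1 * D.
  apply: Rmult_le_compat => //; last exact: norm_ge_0.
  by apply: pow_le; apply: Rlt_le; apply: Rdiv_lt_0_compat; lra.
have := HL m; rewrite -/w; lra.
Qed.

Lemma average_diff_le (N : B -> R) (f g : nat -> B) y m : is_norm N ->
  (forall i, N (minus (f i) (g i)) <= y) ->
  N (minus (scal (/ RtoC (INR m.+1))%C (sum_n f m))
           (scal (/ RtoC (INR m.+1))%C (sum_n g m))) <= y.
Proof.
move=> NN H.
have -> : minus (scal (/ RtoC (INR m.+1))%C (sum_n f m))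
      (scal (/ RtoC (INR m.+1))%C (sum_n g m))
    = scal (/ RtoC (INR m.+1))%C (sum_n (fun i => minus (f i) (g i)) m).
  have -> : sum_n (fun i => minus (f i) (g i)) m
      = plus (sum_n f m) (scal (RtoC (-1)) (sum_n g m)).
    rewrite -(sum_n_scal_l (RtoC (-1)) g) -sum_n_plus.
    by apply: sum_n_ext => i; module_ring B.
  by module_ring B.
rewrite (is_norm_scal NN) Cmod_inv; last exact: RtoC_INR_neq0.
have m0 : 0 < INR m.+1 by apply: lt_0_INR; lia.
rewrite Cmod_R Rabs_pos_eq; last lra.
apply: (Rmult_le_reg_l (INR m.+1)) => //.
rewrite -Rmult_assoc Rinv_r ?Rmult_1_l; last lra.
by apply: is_norm_sum.
Qed.

Lemma circle_proj_lipschitz rho1 rho2 s phi : 0 < rho1 -> 0 < rho2 <= s ->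
  circle_regular rho1 -> circle_regular rho2 ->
  norm (minus (circle_proj P c rho1 phi) (circle_proj P c rho2 phi))
    <= (/ k + s * (/ k * / k)) * Rabs (rho1 - rho2) * norm phi.
Proof.
move=> r1 [r2 r2s] H1 H2.
have cv := cv_inv_minus _ _ _ _ (circle_proj_cv rho1 phi r1 H1)
  (circle_proj_cv rho2 phi r2 H2).
apply: (cv_inv_le norm 1 _ _ _ 0 NB norm_le1 Rle_0_1 cv) => m _.
rewrite /moment; apply: average_diff_le => // i.
set z1 := node rho1 m i; set z2 := node rho2 m i.
have R1 := circle_regular_node rho1 m i r1 H1.
have R2 := circle_regular_node rho2 m i r2 H2.
rewrite -/z1 -/z2 in R1 R2.
set u1 := resolvent P _ phi; set u2 := resolvent P _ phi.
have -> : minus (scal (z1 ^ 1)%C u1) (scal (z2 ^ 1)%C u2)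
    = plus (scal (z1 - z2)%C u1) (scal z2 (minus u1 u2)).
  by rewrite -[(z1 ^ 1)%C]/(z1 * 1)%C -[(z2 ^ 1)%C]/(z2 * 1)%C; module_ring B.
apply: Rle_trans (is_norm_triangle NB _ _) _.
rewrite !(is_norm_scal NB).
have dz : Cmod (z1 - z2)%C = Rabs (rho1 - rho2).
  have -> : (z1 - z2 = RtoC (rho1 - rho2)
      * cis (INR i * (2 * PI / INR m.+1)))%C.
    by rewrite /z1 /z2 /node RtoC_minus; ring.
  by rewrite Cmod_mult Cmod_cis Cmod_R Rmult_1_r.
rewrite dz Cmod_node; last lra.
have X1 : norm u1 <= / k * norm phi by apply: resolvent_bound.
have X2 := resolvent_lipschitz _ P k _ _ phi k_pos R1 R2.
have E : (c + z1 - (c + z2) = z1 - z2)%C by ring.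
rewrite E dz -/u1 -/u2 in X2.
have a0 := Rabs_pos (rho1 - rho2).
have Y1 := Rmult_le_compat_l _ _ _ a0 X1.
have Y2 : rho2 * norm (minus u1 u2)
    <= s * (Rabs (rho1 - rho2) * (/ k * (/ k * norm phi))).
  by apply: Rmult_le_compat => //; [lra | exact: norm_ge_0].
lra.
Qed.

Section Annulus.

Variables s1 s2 : R.
Hypotheses (s1_pos : 0 < s1) (s12 : s1 < s2).
Hypothesis regular_annulus :
  forall rho, s1 <= rho <= s2 -> circle_regular rho.

Let Lam := / k + s2 * (/ k * / k).

Lemma Lam_pos : 0 < Lam.
Proof.
have ik : 0 < / k by apply: Rinv_0_lt_compat.
have : 0 < s2 * (/ k * / k).
  by apply: Rmult_lt_0_compat; [lra | apply: Rmult_lt_0_compat].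
rewrite /Lam; lra.
Qed.

Lemma annulus_lipschitz rho rho' phi : s1 <= rho <= s2 -> s1 <= rho' <= s2 ->
  norm (minus (circle_proj P c rho phi) (circle_proj P c rho' phi))
    <= Lam * Rabs (rho - rho') * norm phi.
Proof.
move=> H H'; apply: circle_proj_lipschitz; try lra; exact: regular_annulus.
Qed.

(** Idempotence follows from the composition of two nearby radii, by continuity
    in the radius. *)
Lemma circle_proj_idempotent rho phi : s1 <= rho <= s2 ->
  circle_proj P c rho (circle_proj P c rho phi) = circle_proj P c rho phi.
Proof.
move=> H; have L0 := Lam_pos; have Hr := regular_annulus rho H.
have r0 : 0 < rho by lra.
set E := circle_proj P c rho.
have EL : is_linear E := circle_proj_linear rho r0 Hr.
have near e : 0 < e -> exists rho', s1 <= rho' <= s2 /\ Rabs (rho - rho') <= e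
    /\ rho <> rho'.
  move=> e0; case: (Rlt_le_dec rho s2) => H2.
    exists (rho + Rmin e (s2 - rho)).
    have a : 0 < Rmin e (s2 - rho) by apply: Rmin_pos; lra.
    have b := Rmin_l e (s2 - rho); have d := Rmin_r e (s2 - rho).
    split; first lra.
    split; last lra.
    rewrite Rabs_left; lra.
  exists (rho - Rmin e (rho - s1)).
  have a : 0 < Rmin e (rho - s1) by apply: Rmin_pos; lra.
  have b := Rmin_l e (rho - s1); have d := Rmin_r e (rho - s1).
  split; first lra.
  split; last lra.
  rewrite Rabs_pos_eq; lra.
set K := (rho / k + 1) * Lam * norm phi.
have rk : 0 < rho / k by apply: Rdiv_lt_0_compat.
have n0 := norm_ge_0 phi.
have K0 : 0 <= K by do 2![apply: Rmult_le_pos => //; try lra].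
have Z : minus (E (E phi)) (E phi) = zero.
  apply: norm_small_zero => e e0.
  have [|rho' [H' [He ne]]] := near (e / (K + 1)).
    by apply: Rdiv_lt_0_compat; lra.
  have Hr' := regular_annulus rho' H'.
  set F := circle_proj P c rho'.
  have d1 : norm (minus (E phi) (F phi)) <= Lam * (e / (K + 1)) * norm phi.
    apply: Rle_trans (annulus_lipschitz rho rho' phi H H') _.
    by apply: Rmult_le_compat_r => //; apply: Rmult_le_compat_l; lra.
  have d2 : norm (minus (E (E phi)) (E (F phi)))
      <= rho / k * (Lam * (e / (K + 1)) * norm phi).
    have -> : minus (E (E phi)) (E (F phi)) = E (minus (E phi) (F phi)).
      by rewrite (linear_minus _ _ _ EL).
    apply: Rle_trans (circle_proj_norm rho _ r0 Hr) _.
    by apply: Rmult_le_compat_l; lra.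
  have d3 : norm (minus (E (F phi)) (E phi)) <= Lam * (e / (K + 1)) * norm phi.
    case: (Rlt_le_dec rho rho') => lt.
      have [EF _] := circle_proj_comp rho rho' phi r0 lt Hr Hr'.
      rewrite /E /F EF minus_eq_zero norm_zero.
      by apply: Rle_trans d1; apply: norm_ge_0.
    have {}lt : rho' < rho by lra.
    have r'0 : 0 < rho' by lra.
    have [_ EF] := circle_proj_comp rho' rho phi r'0 lt Hr' Hr.
    by rewrite /E /F EF (is_norm_sym NB).
  have -> : minus (E (E phi)) (E phi) = plus (minus (E (E phi)) (E (F phi)))
      (minus (E (F phi)) (E phi)) by module_ring B.
  apply: Rle_trans (is_norm_triangle NB _ _) _.
  have : K * (e / (K + 1)) <= e.
    apply: (Rmult_le_reg_r (K + 1)); first lra.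
    have -> : K * (e / (K + 1)) * (K + 1) = K * e by field; lra.
    nra.
  rewrite {1}/K; lra.
have -> : E (E phi) = plus (minus (E (E phi)) (E phi)) (E phi)
  by module_ring B.
by rewrite Z plus_zero_l.
Qed.

(** The difference of the projections of two radii is again idempotent, and an
    idempotent of norm less than one vanishes. *)
Lemma circle_proj_near rho1 rho2 phi :
  s1 <= rho1 <= s2 -> s1 <= rho2 <= s2 -> rho1 <= rho2 ->
  Lam * (rho2 - rho1) <= / 2 ->
  circle_proj P c rho1 phi = circle_proj P c rho2 phi.
Proof.
move=> H1 H2 H12 small.
have [lt|<- //] := Rle_lt_or_eq_dec _ _ H12.
have r1 : 0 < rho1 by lra.
set E1 := circle_proj P c rho1; set E2 := circle_proj P c rho2.
have R1 := regular_annulus rho1 H1; have R2 := regular_annulus rho2 H2.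
have EL1 : is_linear E1 := circle_proj_linear rho1 r1 R1.
have EL2 : is_linear E2 by apply: circle_proj_linear => //; lra.
have [C12 C21] := circle_proj_comp rho1 rho2 phi r1 lt R1 R2.
have I1 := circle_proj_idempotent rho1 phi H1.
have I2 := circle_proj_idempotent rho2 phi H2.
rewrite -/E1 -/E2 in C12 C21 I1 I2.
set x := minus (E2 phi) (E1 phi).
have xE : minus (E2 x) (E1 x) = x.
  rewrite /x (linear_minus _ _ _ EL1) (linear_minus _ _ _ EL2).
  by rewrite I1 I2 C12 C21; module_ring B.
have := annulus_lipschitz rho2 rho1 x H2 H1; rewrite -/E1 -/E2 xE.
rewrite Rabs_pos_eq; last lra.
have n0 := norm_ge_0 x => H.
have : Lam * (rho2 - rho1) * norm x <= / 2 * norm x.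
  exact: Rmult_le_compat_r.
move=> H'; have x0 : norm x = 0 by lra.
move/norm_eq_zero: x0 => x0.
have -> : E2 phi = plus x (E1 phi) by rewrite /x; module_ring B.
by rewrite x0 plus_zero_l.
Qed.

Lemma circle_proj_radius phi :
  circle_proj P c s1 phi = circle_proj P c s2 phi.
Proof.
have L0 := Lam_pos.
have LL : 0 < 2 * Lam * (s2 - s1) by apply: Rmult_lt_0_compat; lra.
have [n [Hn n0]] := archimed_cor1 _ (Rinv_0_lt_compat _ LL).
have n1 : 0 < INR n by apply: lt_0_INR.
pose h := (s2 - s1) / INR n.
have h0 : 0 < h by apply: Rdiv_lt_0_compat; lra.
have hs : Lam * h <= / 2.
  apply: (Rmult_le_reg_l (2 * INR n)); first lra.
  have -> : 2 * INR n * (Lam * h) = 2 * Lam * (s2 - s1).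
    by rewrite /h; field; lra.
  have -> : 2 * INR n * / 2 = INR n by field.
  rewrite -(Rinv_inv (INR n)) -(Rinv_inv (2 * Lam * (s2 - s1))).
  apply: Rlt_le; apply: Rinv_lt_contravar => //.
  by apply: Rmult_lt_0_compat; [apply: Rinv_0_lt_compat|apply: Rinv_0_lt_compat].
suff H j : (j <= n)%nat ->
    circle_proj P c s1 phi = circle_proj P c (s1 + INR j * h) phi.
  rewrite (H n (leqnn n)); congr (circle_proj P c _ phi).
  by rewrite /h; field; lra.
have nh : INR n * h = s2 - s1 by rewrite /h; field; lra.
elim: j => [|j IH] jn; first by rewrite /= Rmult_0_l Rplus_0_r.
rewrite IH; last exact: ltnW.
have j0 := pos_INR j.
have jn' : INR j.+1 * h <= INR n * h.
  by apply: Rmult_le_compat_r; [lra | apply: le_INR; apply/leP].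
have jh : 0 <= INR j * h by apply: Rmult_le_pos; lra.
rewrite S_INR in jn' *.
by apply: circle_proj_near; lra.
Qed.

End Annulus.

(** Around the origin [T = P], and [P^n] multiplies the integrand by [z^n] up to
    terms whose averages over the nodes vanish. *)
Lemma iter_circle_proj_le (N : B -> R) C rho n phi y : c = RtoC 0 ->
  is_norm N -> (forall u, N u <= C * norm u) -> 0 <= C ->
  0 < rho -> circle_regular rho ->
  (forall z, Cmod (z - c)%C = rho -> N (resolvent P z phi) <= y) ->
  N (Nat.iter n P (circle_proj P c rho phi)) <= rho ^ n.+1 * y.
Proof.
move=> c0 NN NC C0 r0 H Hy.
have cv := cv_inv_linear _ _ _ (is_linear_iter _ P n P_linear)
  (circle_proj_cv rho phi r0 H).
apply: (cv_inv_le N C _ _ _ n NN NC C0 cv) => m nm.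
have -> : Nat.iter n P (moment rho m 0 phi) = moment rho m n phi.
  rewrite -(iter_shifted_moment rho m n) //.
  elim: n {cv nm} => [//|n /= ->].
  by rewrite /shifted c0; module_ring B.
exact: moment_bound.
Qed.

End RieszProjections.

(** * Operator norms and ranks *)

Section OperatorNormsAndRanks.

Variable B : CompleteNormedModule C_AbsRing.
Let NB := norm_is_norm B.

Lemma op_norm_le (N : B -> R) (T : B -> B) (y : R) :
  (forall phi, norm phi <= 1 -> N (T phi) <= y) -> Rbar_le (op_norm N T) y.
Proof.
move=> H; rewrite /op_norm; set E := fun x => _.
have [_ lub] := Lub_Rbar_correct E.
by apply: lub => x [phi [n1 ->]]; apply: H.
Qed.

(** Finiteness has to be assumed: the real part of an infinite supremum is zero. *)
Lemma op_norm_bound (N : B -> R) (T : B -> B) (y : R) : is_norm N ->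
  (forall (a : C) x, T (scal a x) = scal a (T x)) ->
  Rbar_lt (op_norm N T) y ->
  0 <= real (op_norm N T) < y /\
  forall phi, N (T phi) <= real (op_norm N T) * norm phi.
Proof.
move=> NN TS; rewrite /op_norm; set E := fun x => _.
have [ub _] := Lub_Rbar_correct E.
have T0 : T zero = zero.
  have := TS (RtoC 0) zero.
  by rewrite scal_zero_r => ->; exact: (scal_zero_l (T zero)).
have E0 : E 0.
  exists zero; rewrite norm_zero T0 (is_norm_zero NN); split => //; lra.
move=> H; have := ub 0 E0.
case: (Lub_Rbar E) ub H => [l||] //= ub H l0.
split => // phi.
case: (Req_dec (norm phi) 0) => [/norm_eq_zero ->|n0].
  by rewrite T0 (is_norm_zero NN) norm_zero; lra.
have npos : 0 < norm phi by have := norm_ge_0 phi; lra.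
have ni : 0 < / norm phi by apply: Rinv_0_lt_compat.
have Eu : E (N (T (scal (RtoC (/ norm phi)) phi))).
  exists (scal (RtoC (/ norm phi)) phi); split => //.
  rewrite (is_norm_scal NB) Cmod_R Rabs_pos_eq; last lra.
  by rewrite Rinv_l; lra.
have := ub _ Eu => /=.
rewrite TS (is_norm_scal NN) Cmod_R Rabs_pos_eq; last lra.
move=> X; have := Rmult_le_compat_r _ _ _ (Rlt_le _ _ npos) X.
rewrite (_ : / norm phi * N (T phi) * norm phi = N (T phi)) //; field; lra.
Qed.

Lemma rank_le (S T : B -> B) : is_linear S -> is_linear T ->
  (forall phi, T (S phi) = zero -> S phi = zero) ->
  Rbar_le (rank S) (rank T).
Proof.
move=> SL TL inj; rewrite /rank.
set E := fun x => _; set F := fun x => _.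
have [_ lub] := Lub_Rbar_correct E; have [ub _] := Lub_Rbar_correct F.
apply: lub => x [n [e [-> H]]]; apply: ub.
exists n, (fun i => S (e i)); split => // c Hc.
apply: H.
have lin (A : B -> B) (f : nat -> B) : is_linear A ->
    A (sum_n_m (fun i => scal (c i) (f i)) 1 n)
    = sum_n_m (fun i => scal (c i) (A (f i))) 1 n.
  move=> AL; elim: (n) => [|m IH].
    by rewrite !sum_n_m_zero // linear_zero.
  rewrite !sum_n_Sm; [|lia|lia].
  by rewrite (linear_plus _ AL) IH (linear_scal _ AL).
rewrite -(lin S e SL); apply: inj; rewrite !lin //.
Qed.

(** On the range of [E] the assumed bound makes the Banach norm smaller than a
    multiple of the weak norm, in which [F] is close to [E]. So [F] is injective
    on that range, even if it is infinite-dimensional. *)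
Lemma projection_rank_le (nw : B -> R) (E F : B -> B) (a b q : R) :
  is_norm nw -> is_linear E -> is_linear F ->
  (forall phi, E (E phi) = E phi) ->
  (forall phi, norm (E phi) <= a * norm phi + b * nw phi) ->
  (forall phi, nw (minus (E phi) (F phi)) <= q * norm phi) ->
  0 <= q -> a < 1 -> q * b < 1 - a -> Rbar_le (rank E) (rank F).
Proof.
move=> NW EL FL EE Eb EF q0 a1 qb; apply: rank_le => // phi.
set psi := E phi => F0.
have X := Eb psi; rewrite {1}/psi EE -/psi in X.
have Y := EF psi; rewrite {1}/psi EE -/psi F0 minus_zero_r in Y.
have w0 := is_norm_ge0 NW psi.
have : nw psi = 0 by nra.
by case: NW => _ [_]; apply.
Qed.

Lemma circle_proj_diff_le (N : B -> R) C (P Q : B -> B) c k rho phi y :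
  0 < k -> is_norm N ->
  (forall u, N u <= C * norm u) -> 0 <= C -> 0 < rho ->
  circle_regular B P c k rho -> circle_regular B Q c k rho ->
  (forall z, Cmod (z - c)%C = rho ->
     N (minus (resolvent P z phi) (resolvent Q z phi)) <= y) ->
  N (minus (circle_proj P c rho phi) (circle_proj Q c rho phi)) <= rho * y.
Proof.
move=> k0 NN NC C0 r0 HP HQ Hy.
have cv := cv_inv_minus _ _ _ _ _
  (circle_proj_cv B P c k k0 rho phi r0 HP)
  (circle_proj_cv B Q c k k0 rho phi r0 HQ).
apply: (cv_inv_le _ N C _ _ _ 0 NN NC C0 cv) => m _.
apply: average_diff_le => // i.
set z := node rho m i.
have -> : minus (scal (z ^ 1)%C (resolvent P (c + z)%C phi))
    (scal (z ^ 1)%C (resolvent Q (c + z)%C phi))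
  = scal z (minus (resolvent P (c + z)%C phi) (resolvent Q (c + z)%C phi)).
  by rewrite -[(z ^ 1)%C]/(z * 1)%C; module_ring B.
rewrite (is_norm_scal NN) Cmod_node; last lra.
apply: Rmult_le_compat_l; first lra.
apply: Hy; have -> : (c + z - c = z)%C by ring.
by rewrite Cmod_node; lra.
Qed.

End OperatorNormsAndRanks.

(** * The perturbation theorem *)

(** The difference is estimated on the inner circle of radius [rho], the norms
    on the outer one; both circles define the same projections. *)
Lemma perturbed_projection (B : CompleteNormedModule C_AbsRing)
    (nw : B -> R) (C : R) (P Q : B -> B) (c : Complex.C)
    (k rho delta a b q : R) :
  is_norm nw -> (forall phi, nw phi <= C * norm phi) -> 0 <= C ->
  is_linear P -> is_linear Q -> 0 < k -> 0 < rho < delta ->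
  (forall z, rho <= Cmod (z - c)%C <= delta -> regular P k z /\ regular Q k z) ->
  (forall z phi, Cmod (z - c)%C = delta ->
     norm (resolvent P z phi) <= a * norm phi + b * nw phi /\
     norm (resolvent Q z phi) <= a * norm phi + b * nw phi) ->
  (forall z phi, Cmod (z - c)%C = rho ->
     nw (minus (resolvent Q z phi) (resolvent P z phi)) <= q * norm phi) ->
  0 <= q -> delta * a < 1 -> delta * q * (delta * b) < 1 - delta * a ->
  rank (circle_proj Q c delta) = rank (circle_proj P c delta) /\
  (forall phi, norm (circle_proj Q c delta phi)
     <= delta * (a * norm phi + b * nw phi)) /\
  (forall phi, nw (minus (circle_proj Q c delta phi) (circle_proj P c delta phi))
     <= delta * q * norm phi).
Proof.
move=> NW nwC C0 PL QL k0 [r0 rd] Hreg Hnorm Hdiff q0 a1 small.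
have d0 : 0 < delta by lra.
have RP s : rho <= s <= delta -> circle_regular B P c k s.
  by move=> Hs z Hz; apply: (proj1 (Hreg z _)); rewrite Hz.
have RQ s : rho <= s <= delta -> circle_regular B Q c k s.
  by move=> Hs z Hz; apply: (proj2 (Hreg z _)); rewrite Hz.
have in1 : rho <= rho <= delta by lra.
have in2 : rho <= delta <= delta by lra.
have bound T : (forall z phi, Cmod (z - c)%C = delta ->
      norm (resolvent T z phi) <= a * norm phi + b * nw phi) ->
    circle_regular B T c k delta ->
    forall phi, norm (circle_proj T c delta phi)
      <= delta * (a * norm phi + b * nw phi).
  move=> HT RT phi.
  apply: (circle_proj_le B T c k k0 norm 1) => //; try lra.
  - exact: norm_is_norm.
  - exact: norm_le1.
  by move=> z Hz; apply: HT.
have boundP := bound P (fun z phi Hz => proj1 (Hnorm z phi Hz)) (RP _ in2).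
have boundQ := bound Q (fun z phi Hz => proj2 (Hnorm z phi Hz)) (RQ _ in2).
have diff phi : nw (minus (circle_proj Q c delta phi)
    (circle_proj P c delta phi)) <= delta * q * norm phi.
  rewrite -(circle_proj_radius B P PL c k k0 rho delta r0 rd RP phi).
  rewrite -(circle_proj_radius B Q QL c k k0 rho delta r0 rd RQ phi).
  apply: (Rle_trans _ (rho * (q * norm phi))).
    apply: (circle_proj_diff_le B nw C Q P c k) => //; [exact: RQ | exact: RP |].
    by move=> z; apply: Hdiff.
  rewrite Rmult_assoc; apply: Rmult_le_compat_r; last lra.
  by apply: Rmult_le_pos => //; apply: norm_ge_0.
split; last by split.
have dq : 0 <= delta * q by apply: Rmult_le_pos; lra.
have linP := circle_proj_linear B P PL c k k0 delta d0 (RP _ in2).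
have linQ := circle_proj_linear B Q QL c k k0 delta d0 (RQ _ in2).
have idP phi := circle_proj_idempotent B P PL c k k0 rho delta r0 rd RP
  delta phi in2.
have idQ phi := circle_proj_idempotent B Q QL c k k0 rho delta r0 rd RQ
  delta phi in2.
apply: Rbar_le_antisym.
  apply: (projection_rank_le B nw _ _ (delta * a) (delta * b) (delta * q)) => //.
  by move=> phi; have := boundQ phi; lra.
apply: (projection_rank_le B nw _ _ (delta * a) (delta * b) (delta * q)) => //.
  by move=> phi; have := boundP phi; lra.
by move=> phi; rewrite (is_norm_sym NW).
Qed.

Theorem proposition1
  (B : CompleteNormedModule C_AbsRing)
  (nw : B -> R) (nw_norm : is_norm nw)
  (F : AbsRing) (F_real_or_complex : F = R_AbsRing \/ F = C_AbsRing)
  (d : nat)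
  (I : {ffun 'I_d -> F} -> Prop) (I_proper : exists v, ~ I v)
  (P : {ffun 'I_d -> F} -> B -> B)
  (P_bounded : forall v, I v -> is_linear (P v))
  (o : {ffun 'I_d -> F}) (o_in_I : I o)
  (C0 M theta : R)
  (C0_pos : 0 < C0) (M_pos : 0 < M)
  (theta_pos : 0 < theta) (theta_lt1 : theta < 1) (theta_ltM : theta < M)
  (H1 : forall phi : B, nw phi <= C0 * norm phi)
  (H2 : forall v, I v -> forall n : nat, (1 <= n)%nat -> forall phi : B,
     nw (Nat.iter n (P v) phi) <= C0 * M ^ n * nw phi)
  (H3 : forall v, I v -> forall n : nat, (1 <= n)%nat -> forall phi : B,
     norm (Nat.iter n (P v) phi)
       <= C0 * theta ^ n * norm phi + C0 * M ^ n * nw phi)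
  (H4 : forall v, I v -> forall z : C,
     spectrum (P v) z -> theta < Cmod z -> ~ residual_spectrum (P v) z)
  (H5 : forall e : R, 0 < e -> exists h : R, 0 < h /\
     forall v, I v -> euclid_dist v o < h ->
       Rbar_lt (op_norm nw (op_minus (P o) (P v))) e) :
  let tau v := real (op_norm nw (op_minus (P o) (P v))) in
  forall r : R, theta < r < M ->
  let eta := ln (r / theta) / ln (M / theta) in
  let rate v := rpow (tau v) (1 / 2) + rpow (tau v) (eta / (2 * (1 - eta))) in
  0 < eta < 1 /\
  exists a : R, 0 < a /\
  forall delta : R, 0 < delta ->
  exists eps b : R, 0 < eps /\ 0 < b /\
  (exists K : R, 0 < K /\
    forall v, I v -> euclid_dist v o <= eps ->
    forall z : C, ~ V_region (P o) delta r z ->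
      ~ spectrum (P v) z /\
      (forall phi : B, norm (resolvent (P v) z phi) <= a * norm phi + b * nw phi) /\
      Rbar_le (op_norm nw (op_minus (resolvent (P v) z) (resolvent (P o) z)))
              (K * rate v)) /\
  (delta < / a ->
    exists eps' K' : R, 0 < eps' /\ 0 < K' /\
    forall lambda : C,
      isolated_eigenvalue (P o) lambda -> r < Cmod lambda ->
      (forall z : C, spectrum (P o) z /\ Cmod (z - lambda)%C < delta <-> z = lambda) ->
      (forall z : C, Cmod (z - lambda)%C = delta -> ~ spectrum (P o) z) ->
    forall v, I v -> euclid_dist v o <= eps' ->
      (forall z : C, Cmod (z - lambda)%C = delta -> ~ spectrum (P v) z) /\
      rank (circle_proj (P v) lambda delta) = rank (circle_proj (P o) lambda delta) /\
      Rbar_le (op_norm norm (circle_proj (P v) lambda delta)) (delta * (a + b)) /\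
      Rbar_le (op_norm nw (op_minus (circle_proj (P v) lambda delta)
                                    (circle_proj (P o) lambda delta)))
              (K' * rate v)) /\
  ((forall z : C, Cmod z = r -> ~ spectrum (P o) z) ->
    forall v, I v -> euclid_dist v o <= eps ->
      (forall z : C, Cmod z = r -> ~ spectrum (P v) z) /\
      forall n : nat, (1 <= n)%nat ->
        Rbar_le (op_norm norm
                   (fun phi => Nat.iter n (P v) (circle_proj (P v) (RtoC 0) r phi)))
                (r ^ n.+1 * (a + b))).
Proof.
move=> tau r rr eta rate; have [tr rM] := rr.
have [eta0 eta1] : 0 < eta < 1 := exponent_bounds theta r M theta_pos rr.
split=> //.
pose C := Rmax 1 C0.
have C1 : 1 <= C by apply: Rmax_l.
have CC0 : C0 <= C by apply: Rmax_r.
have nw0 phi : 0 <= nw phi by apply: is_norm_ge0.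
have nwC phi : nw phi <= C * norm phi.
  by apply: Rle_trans (H1 phi) _; apply: Rmult_le_compat_r; [apply: norm_ge_0|].
have powle x n : 0 < x -> C0 * x ^ n <= C * x ^ n.
  by move=> x0; apply: Rmult_le_compat_r => //; apply: pow_le; lra.
have LY v : I v -> lasota_yorke nw C M theta (P v).
  move=> Iv; split; first exact: P_bounded.
  split; case=> [|n] phi.
  - by have := nw0 phi; rewrite /=; nra.
  - apply: Rle_trans (H2 v Iv n.+1 isT phi) _.
    by apply: Rmult_le_compat_r => //; apply: powle.
  - by have := nw0 phi; have := norm_ge_0 phi; rewrite /=; nra.
  apply: Rle_trans (H3 v Iv n.+1 isT phi) _.
  apply: Rplus_le_compat; apply: Rmult_le_compat_r => //; try exact: powle.
  exact: norm_ge_0.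
pose r1 := (theta + r) / 2.
have rr1 : theta < r1 < M by rewrite /r1; lra.
have r1r : r1 < r by rewrite /r1; lra.
have [a0 [a00 Hstab]] := stability B nw nw_norm C M theta C1 theta_pos nwC r1 rr1.
(* The second term ensures that a circle of radius less than [/ a] around a
   point outside the disk of radius [r] stays in [r1 <= |z|]. *)
pose a := a0 + / (r - r1).
have ir : 0 < / (r - r1) by apply: Rinv_0_lt_compat; lra.
exists a; split; first by rewrite /a; lra.
move=> delta delta0.
have PoL := P_bounded o o_in_I.
have [k1 [k10 Hk1]] := V_region_bdd_below B (P o) PoL delta r delta0.
have [k2 [k20 Hk2]] := isolated_annuli_bdd_below B (P o) PoL delta r delta0.
have [k3 [k30 Hk3]] : exists k, 0 < k /\
    ((forall z, Cmod z = r -> ~ spectrum (P o) z) ->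
     forall z, Cmod z = r -> bdd_below (P o) k z).
  case: (classic (forall z, Cmod z = r -> ~ spectrum (P o) z)) => Hr; last first.
    by exists 1; split; first lra.
  have c0 (z : Complex.C) : (z - RtoC 0 = z)%C by ring.
  have [z|k [k0 Hk]] := annulus_bdd_below B (P o) PoL (RtoC 0) r r.
    by rewrite c0 => Hz; apply: Hr; lra.
  by exists k; split => // _ z Hz; apply: Hk; rewrite c0; lra.
pose k := Rmin k1 (Rmin k2 k3).
have k0 : 0 < k by do 2?[apply: Rmin_pos => //].
have kk1 : k <= k1 by apply: Rmin_l.
have kk2 : k <= k2 by apply: Rle_trans (Rmin_r _ _) (Rmin_l _ _).
have kk3 : k <= k3 by apply: Rle_trans (Rmin_r _ _) (Rmin_r _ _).
have [t0 [b0 [t00 [b00 Hst]]]] := Hstab k k0.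
have m0 : 0 < Rmin t0 1 by apply: Rmin_pos; lra.
have close e : 0 < e -> exists h, 0 < h /\ forall v, I v -> euclid_dist v o <= h ->
    0 <= tau v < e /\
    forall phi, nw (minus (P o phi) (P v phi)) <= tau v * norm phi.
  move=> e0; have [h [h0 Hh]] := H5 e e0.
  exists (h / 2); split; first lra.
  move=> v Iv dv; apply: op_norm_bound => //; last by apply: Hh => //; lra.
  move=> s x; rewrite /op_minus (linear_scal _ PoL).
  by rewrite (linear_scal _ (P_bounded v Iv)); module_ring B.
have [eps [eps0 Heps]] := close _ m0.
(* On the unit ball of the Banach norm [nw] is at most [C], so that this factor
   yields the operator norm bounds [a + b]. *)
pose b := b0 * C.
have b0b : b0 <= b by rewrite /b; nra.
have bpos : 0 < b by lra.
have apos : 0 < a by rewrite /a; lra.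
pose k' := / (a + b).
have k'0 : 0 < k' by apply: Rinv_0_lt_compat; lra.
(* Stated for [Q] with a closeness bound rather than for the distance of [v] to
   [o], so that it also applies to [P o] itself. *)
have main Q v : I v -> Q = P v ->
    (forall phi, nw (minus (P o phi) (Q phi)) <= t0 * norm phi) ->
    forall z, r1 <= Cmod z -> bdd_below (P o) k z ->
    regular Q k' z /\
    forall phi, norm (resolvent Q z phi) <= a * norm phi + b0 * nw phi.
  move=> Iv QE HQ z rz Hz.
  have est phi : norm phi <= a * norm (z_minus z Q phi) + b0 * nw (z_minus z Q phi).
    have := Hst (P o) Q (LY o o_in_I) _ HQ z rz Hz phi.
    rewrite QE => /(_ (LY v Iv)) X; apply: Rle_trans X _.
    apply: Rplus_le_compat_r; apply: Rmult_le_compat_r; first exact: norm_ge_0.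
    rewrite /a; lra.
  have low : bdd_below Q k' z.
    move=> phi; apply: (Rmult_le_reg_l (a + b)); first lra.
    rewrite -Rmult_assoc Rinv_r ?Rmult_1_l; last lra.
    apply: Rle_trans (est phi) _; rewrite /b.
    have := Rmult_le_compat_l _ _ _ (Rlt_le _ _ b00) (nwC (z_minus z Q phi)).
    lra.
  have ns : ~ spectrum Q z.
    apply: (bdd_below_not_spectrum B Q k') => //; first by rewrite QE; apply: P_bounded.
    by rewrite QE => S; apply: H4 => //; lra.
  split=> // phi.
  by have := est (resolvent Q z phi); rewrite not_spectrum_right.
have maino := main (P o) o o_in_I erefl.
have {}maino : forall z, r1 <= Cmod z -> bdd_below (P o) k z ->
    regular (P o) k' z /\
    forall phi, norm (resolvent (P o) z phi) <= a * norm phi + b0 * nw phi.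
  apply: maino => phi; rewrite minus_eq_zero (is_norm_zero nw_norm).
  by apply: Rmult_le_pos; [lra | apply: norm_ge_0].
have mainv v : I v -> euclid_dist v o <= eps ->
    forall z, r1 <= Cmod z -> bdd_below (P o) k z ->
    regular (P v) k' z /\
    forall phi, norm (resolvent (P v) z phi) <= a * norm phi + b0 * nw phi.
  move=> Iv dv; apply: (main _ v) => // phi.
  have [[_ tv] Hv] := Heps v Iv dv.
  apply: Rle_trans (Hv phi) _; apply: Rmult_le_compat_r; first exact: norm_ge_0.
  have := Rmin_l t0 1; lra.
have [K [K0 HK]] := resolvent_rate B nw nw_norm C M theta C1 theta_pos nwC
  r rr k' k'0.
have rate0 v : 0 <= rate v.
  by have := rpow_ge0 (tau v) (1 / 2);
    have := rpow_ge0 (tau v) (eta / (2 * (1 - eta))); rewrite /rate; lra.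
have diff v : I v -> euclid_dist v o <= eps ->
    forall z, r <= Cmod z -> bdd_below (P o) k z -> forall phi,
    nw (minus (resolvent (P v) z phi) (resolvent (P o) z phi))
      <= K * rate v * norm phi.
  move=> Iv dv z rz Hz phi.
  have [||[nso lo] _] := maino z => //; first lra.
  have [||[nsv lv] _] := mainv v Iv dv z => //; first lra.
  have [[tv0 tv1] Hv] := Heps v Iv dv.
  have := HK (P o) (P v) (tau v) (LY o o_in_I) (LY v Iv) _ Hv z rz lo lv
    (resolvent (P o) z phi) (resolvent (P v) z phi) _.
  rewrite !not_spectrum_right //; apply => //.
  have := Rmin_r t0 1; lra.
have bC phi : norm phi <= 1 -> a * norm phi + b0 * nw phi <= a + b.
  move=> n1; have n0 := norm_ge_0 phi; rewrite /b.
  have := Rmult_le_compat_l _ _ _ (Rlt_le _ _ b00) (nwC phi).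
  have : 0 < b0 * C by apply: Rmult_lt_0_compat; lra.
  nra.
exists eps, b; split=> //; split=> //; split; [|split].
- exists K; split=> // v Iv dv z Hz.
  have rz : r <= Cmod z.
    by apply: Rnot_lt_le => lt; apply: Hz; left.
  have lowz : bdd_below (P o) k z by apply: bdd_below_le (Hk1 z Hz).
  have [||[ns _] Rv] := mainv v Iv dv z => //; first lra.
  split=> //; split=> [phi|].
    apply: Rle_trans (Rv phi) _; have := nw0 phi; nra.
  apply: op_norm_le => phi n1.
  apply: Rle_trans (diff v Iv dv z rz lowz phi) _.
  have := Rmult_le_pos _ _ (Rlt_le _ _ K0) (rate0 v); nra.
- move=> da.
  have da1 : delta * a < 1.
    have := Rmult_lt_compat_r _ _ _ apos da; rewrite Rinv_l; lra.
  have dr : delta < r - r1.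
    apply: Rlt_le_trans da _; rewrite -(Rinv_inv (r - r1)).
    by apply: Rinv_le_contravar => //; rewrite /a; lra.
  (* When both terms of the rate are at most [q0], the projections are so close
     that the injectivity argument for the ranks applies. *)
  pose q0 := (1 - delta * a) / (4 * (delta * K * (delta * b0))).
  have q00 : 0 < q0.
    apply: Rdiv_lt_0_compat; first lra.
    by do 3?[apply: Rmult_lt_0_compat; try lra].
  have [t1 [t10 Ht1]] := rpow_small (1 / 2) q0 ltac:(lra) q00.
  have ex0 : 0 < eta / (2 * (1 - eta)) by apply: Rdiv_lt_0_compat; lra.
  have [t2 [t20 Ht2]] := rpow_small _ q0 ex0 q00.
  have [h [h0 Hh]] := close (Rmin t1 t2) ltac:(apply: Rmin_pos; lra).
  exists (Rmin eps h), (delta * K); split; first exact: Rmin_pos.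
  split; first exact: Rmult_lt_0_compat.
  move=> lambda [eig _] rl isol circ v Iv dv.
  have [rho [rho0 [rhor Hrho]]] := Hk2 lambda eig rl isol circ.
  have dve : euclid_dist v o <= eps by apply: Rle_trans dv (Rmin_l _ _).
  have dvh : euclid_dist v o <= h by apply: Rle_trans dv (Rmin_r _ _).
  have far z : Cmod lambda - Cmod (z - lambda)%C <= Cmod z.
    rewrite Cmod_sym; have := Cmod_minus_ge lambda (lambda - z)%C.
    by have -> : (lambda - (lambda - z) = z)%C by ring.
  have ann z : rho <= Cmod (z - lambda)%C <= delta ->
      r1 <= Cmod z /\ bdd_below (P o) k z.
    move=> Hz; split; first by have := far z; lra.
    by apply: bdd_below_le (Hrho z Hz).
  have [[tv0 tv1] _] := Hh v Iv dvh.
  have small : rate v <= 2 * q0.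
    have := Ht1 (tau v); have := Ht2 (tau v); have := Rmin_l t1 t2.
    have := Rmin_r t1 t2; rewrite /rate => ? ? X2 X1.
    have := X1 ltac:(lra); have := X2 ltac:(lra); lra.
  have [rk [bd df]] : rank (circle_proj (P v) lambda delta)
        = rank (circle_proj (P o) lambda delta) /\
      (forall phi, norm (circle_proj (P v) lambda delta phi)
         <= delta * (a * norm phi + b0 * nw phi)) /\
      (forall phi, nw (minus (circle_proj (P v) lambda delta phi)
           (circle_proj (P o) lambda delta phi))
         <= delta * (K * rate v) * norm phi).
    apply: (perturbed_projection B nw C (P o) (P v) lambda k' rho) => //.
    + lra.
    + exact: P_bounded.
    + move=> z /ann [rz lz]; split; first by case: (maino z rz lz).
      by case: (mainv v Iv dve z rz lz).
    + move=> z phi Hz.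
      have /ann [rz lz] : rho <= Cmod (z - lambda)%C <= delta by lra.
      by split; [case: (maino z rz lz) | case: (mainv v Iv dve z rz lz)].
    + move=> z phi Hz; apply: diff => //; first by have := far z; lra.
      by apply: (proj2 (ann z _)); lra.
    + by apply: Rmult_le_pos => //; lra.
    have D0 : 0 < delta * K * (delta * b0).
      by do 2?[apply: Rmult_lt_0_compat; try lra].
    have := Rmult_le_compat_l _ _ _ (Rlt_le _ _ D0) small.
    have -> : delta * K * (delta * b0) * (2 * q0) = (1 - delta * a) / 2.
      by rewrite /q0; field; lra.
    lra.
  split.
    move=> z Hz.
    have /ann [rz lz] : rho <= Cmod (z - lambda)%C <= delta by lra.
    by case: (mainv v Iv dve z rz lz) => [[]].
  split=> //; split; apply: op_norm_le => phi n1.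
    apply: Rle_trans (bd phi) _; apply: Rmult_le_compat_l; first lra.
    exact: bC.
  apply: Rle_trans (df phi) _; rewrite -Rmult_assoc.
  have : 0 <= delta * K * rate v.
    by apply: Rmult_le_pos => //; apply: Rmult_le_pos; lra.
  nra.
move=> Hr v Iv dv.
have reg z : Cmod z = r -> regular (P v) k' z /\
    forall phi, norm (resolvent (P v) z phi) <= a * norm phi + b0 * nw phi.
  move=> Hz; apply: mainv => //; first lra.
  by apply: bdd_below_le (Hk3 Hr z Hz).
split=> [z /reg [[]] //|n n1].
have c0 (z : Complex.C) : (z - RtoC 0 = z)%C by ring.
apply: op_norm_le => phi phi1.
apply: (iter_circle_proj_le B (P v) (P_bounded v Iv) (RtoC 0) k' k'0 norm 1) => //.
- exact: norm_is_norm.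
- exact: norm_le1.
- lra.
- lra.
- by move=> z; rewrite c0 => /reg [].
move=> z; rewrite c0 => /reg [_ X].
by apply: Rle_trans (X phi) _; apply: bC.
Qed.
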